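(* Let $\alpha_+,\alpha_->0$ be given. If $\beta_-=0$, $\beta_+=\pi$ and $x_\pm=\pm1$, then for $x\in\mathbb{R}\cup\{\infty\}$ the singular comparison curve $c^x$ belonging to these data satisfies $$W^e_{closed}(S(c^x))=12\pi+4\pi\left(\frac{\alpha_+(x-1)}{\alpha_+^2+(x-1)^2}-\frac{\alpha_-(x+1)}{\alpha_-^2+(x+1)^2}\right),$$ where for $x=\infty$ both fractions are read as their limit $0$. Furthermore, for fixed $\alpha_->0$, $$\liminf_{\alpha_+\to\infty}\ \inf\{W^e_{closed}(S(c^x)) \mid x\in\mathbb{R}\cup\{\infty\}\}\ge 10\pi.$$
   Context: Notation. $\mathbb{H}=\mathbb{R}\times(0,\infty)$, $\overline{\mathbb{H}}=\mathbb{R}\times[0,\infty)$. A curve $\gamma=(\gamma^1,\gamma^2)$ in $\mathbb{H}$ (profile curve) induces a surface of revolution $S(\gamma)$ parametrised by $f_\gamma(s,\varphi)=(\gamma^1(s),\gamma^2(s)\cos\varphi,\gamma^2(s)\sin\varphi)$, $\varphi\in\mathbb{S}^1$. The Willmore energy of an immersed surface in $\mathbb{R}^3$ is $W_e=\frac14\int H^2\,d\mu$, where $H$ is the sum of the principal curvatures and $\mu$ the area measure. Sphere caps. For $x_0\in\mathbb{R}$, $\alpha_0>0$, $\beta_0\in\mathbb{R}$ with $\cos\beta_0\neq0$ let $$\gamma_{circ}(x_0,\alpha_0,\beta_0)=\Bigl\{(x,y)\in\mathbb{H} : |x-x_0-\alpha_0\tan\beta_0|^2+y^2=\tfrac{\alpha_0^2}{\cos^2\beta_0},\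 \cos\beta_0\,(x-x_0)\le 0\Bigr\}.$$ Put $\mathrm{cap}_\pm=S(\gamma_{circ}(x_\pm,\alpha_\pm,\beta_\pm))$. Closed Willmore energy. For a surface $S$ let $\theta^2(\mathcal{H}^2\lfloor S,\infty)=\lim_{r\to\infty}\frac{\mathcal{H}^2(S\cap B_r(0))}{\pi r^2}$ be its 2-density at infinity (area counted with multiplicity). For a profile curve $\gamma$ with the boundary data given by $x_\pm,\alpha_\pm,\beta_\pm$, that is, starting at $(x_-,\alpha_-)$ with unit tangent $(\cos\beta_-,\sin\beta_-)$ and ending at $(x_+,\alpha_+)$ with unit tangent $-(\cos\beta_+,\sin\beta_+)$, $$W^e_{closed}(S(\gamma))=W_e(S(\gamma))+W_e(\mathrm{cap}_-)+W_e(\mathrm{cap}_+)+4\pi\theta^2(\mathcal{H}^2\lfloor S(\gamma),\infty)+4\pi\theta^2(\mathcal{H}^2\lfloor \mathrm{cap}_-,\infty)+4\pi\theta^2(\mathcal{H}^2\lfloor \mathrm{cap}_+,\infty).$$ Comparison curves $c^x$. For every $x\in\mathbb{R}\cup\{\infty\}$ let $c^x_\pm:[0,1]\to\overline{\mathbb{H}}$ be smooth curves with $$c^x_-(0)=(x_-,\alpha_-),\quad c^x_+(0)=(x_+,\alpha_+),\quad \frac{(c^x_\pm)'(0)}{|(c^x_\pm)'(0)|}=(\cos\beta_\pm,\sin\beta_\pm),\quad c^x_\pm(1)=(x,0)$$ (for $x=\infty$ the last condition is read as $\lim_{s\to1}|c^x_\pm(s)|=\infty$), and such that each of $c^x_-,c^x_+$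 is part of a Moebius transformed catenoid or part of a half circle with centre on the $x$-axis. Here a Moebius transformed catenoid (profile curve) means an image of the curve $s\mapsto(s,\cosh s)$ under a Moebius transformation (possibly composed with a reflection) mapping $\mathbb{H}$ to itself. This is taken to be well defined for all $x\in\mathbb{R}\cup\{\infty\}$. The curve $c^x:[0,2]\to\overline{\mathbb{H}}$ is $c^x(s)=c^x_-(s)$ for $s\in[0,1]$ and $c^x(s)=c^x_+(2-s)$ for $s\in[1,2]$. The Willmore energy and the density at infinity of $S(c^x)$ are the sums of those of the two pieces $S(c^x_-)$ and $S(c^x_+)$. *)

(* Defs.v *)
From mathcomp Require Import all_boot all_order all_algebra.
From mathcomp Require Import complex ring lra.
From mathcomp Require Import all_classical all_reals all_analysis.

Set Implicit Arguments.
Unset Strict Implicit.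
Unset Printing Implicit Defensive.

Import Order.TTheory GRing.Theory Num.Theory.
Import numFieldNormedType.Exports.

Local Open Scope classical_set_scope.
Local Open Scope ring_scope.

(* A surface in R^3 is given by a map f : R -> R -> 'rV[R]_3 and a set D of
   parameters (s, t).  Areas and integrals are taken over D, hence count
   multiplicity. *)
Section ParametrisedSurfaces.
Context {R : realType}.
Implicit Types (u v : 'rV[R]_3) (f : R -> R -> 'rV[R]_3) (D : set (R * R)).

Definition dot u v : R := \sum_(i < 3) u 0 i * v 0 i.

(* Euclidean norm; the library norm on matrices is the maximum norm. *)
Definition enorm u : R := Num.sqrt (dot u u).

(* The indices i + 1 and i + 2 are taken modulo 3. *)
Definition cross u v : 'rV[R]_3 :=
  \row_(i < 3) (u 0 (i + 1) * v 0 (i + 2%:R) - u 0 (i + 2%:R) * v 0 (i + 1)).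

Definition partial (k : 'I_2) f (s t : R) : 'rV[R]_3 :=
  \row_(i < 3) if k == 0 then derive1 (fun x => f x t 0 i) s
               else derive1 (fun x => f s x 0 i) t.

Definition unit_normal f s t : 'rV[R]_3 :=
  let n := cross (partial 0 f s t) (partial 1 f s t) in (enorm n)^-1 *: n.

Definition first_form f s t : 'M[R]_2 :=
  \matrix_(i < 2, j < 2) dot (partial i f s t) (partial j f s t).

Definition second_form f s t : 'M[R]_2 :=
  \matrix_(i < 2, j < 2)
    dot (partial i (partial j f) s t) (unit_normal f s t).

(* Matrix of the Weingarten map; its eigenvalues are the principal curvatures. *)
Definition weingarten f s t : 'M[R]_2 :=
  second_form f s t *m invmx (first_form f s t).

Definition sum_principal_curvatures f s t : R := \tr (weingarten f s t).

Definition area_density f s t : R := Num.sqrt (\det (first_form f s t)).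

Definition leb2 := (@lebesgue_measure R \x @lebesgue_measure R)%E.

Definition willmore f D : \bar R :=
  ((4^-1 : R)%:E * \int[leb2]_(p in D)
     (sum_principal_curvatures f p.1 p.2 ^+ 2 * area_density f p.1 p.2)%:E)%E.

Definition area_in_ball f D (r : R) : \bar R :=
  (\int[leb2]_(p in D `&` [set p | (enorm (f p.1 p.2) < r)%R])
     (area_density f p.1 p.2)%:E)%E.

Definition density_at_infinity f D : \bar R :=
  lim ((area_in_ball f D r * ((pi * r ^+ 2)^-1)%:E)%E @[r --> +oo]).

End ParametrisedSurfaces.

Section SurfacesOfRevolution.
Context {R : realType}.
Implicit Types (g : R -> R * R) (I : set R).

Definition revol g (s phi : R) : 'rV[R]_3 :=
  \row_(i < 3) [:: (g s).1; (g s).2 * cos phi; (g s).2 * sin phi]`_i.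

(* Parameters at which the curve meets the axis of revolution are left out. *)
Definition revol_dom g I : set (R * R) :=
  [set p | [/\ I p.1, 0 < (g p.1).2 & 0 <= p.2 < 2 * pi]].

Definition revol_willmore g I : \bar R := willmore (revol g) (revol_dom g I).

Definition revol_density g I : \bar R :=
  density_at_infinity (revol g) (revol_dom g I).

End SurfacesOfRevolution.

Section SphereCaps.
Context {R : realType}.
Implicit Types xc ac bc : R.

Definition gamma_circ xc ac bc : set (R * R) :=
  [set p | [/\ 0 < p.2,
     `|p.1 - xc - ac * tan bc| ^+ 2 + p.2 ^+ 2 = ac ^+ 2 / cos bc ^+ 2 &
     cos bc * (p.1 - xc) <= 0]].

Definition circ_param xc ac bc (t : R) : R * R :=
  (xc + ac * tan bc + ac / `|cos bc| * cos t, ac / `|cos bc| * sin t).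

Definition circ_dom xc ac bc : set R :=
  [set t | 0 < t < pi /\ gamma_circ xc ac bc (circ_param xc ac bc t)].

Lemma circ_paramE xc ac bc : 0 < ac -> cos bc != 0 ->
  set_bij (circ_dom xc ac bc) (gamma_circ xc ac bc) (circ_param xc ac bc).
Proof.
move=> a_gt0 cbN0; set r := ac / `|cos bc|.
have r_gt0 : 0 < r by rewrite divr_gt0 ?normr_gt0.
have r2 : ac ^+ 2 / cos bc ^+ 2 = r ^+ 2.
  by rewrite expr_div_n real_normK ?num_real.
split.
- by move=> t [].
- move=> t u /set_mem[/andP[t0 tpi] _] /set_mem[/andP[u0 upi] _] [/addrI e _].
  have {}e : cos t = cos u by apply: (mulfI (lt0r_neq0 r_gt0)).
  by rewrite -(@cosK R t) ?e ?cosK// in_itv/= !ltW.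
- move=> [x y] /=; rewrite /gamma_circ/= r2 => -[y0 + cx].
  rewrite real_normK ?num_real// => e.
  set z := (x - xc - ac * tan bc) / r.
  have xE : x = xc + ac * tan bc + r * z.
    by rewrite /z; field; exact: lt0r_neq0.
  have ez : r ^+ 2 * (1 - z ^+ 2) = y ^+ 2.
    by move: e; rewrite xE => e; lra.
  have z2 : z ^+ 2 < 1.
    by rewrite -subr_gt0 -(pmulr_rgt0 _ (exprn_gt0 2 r_gt0)) ez exprn_gt0.
  have /andP[z_gt z_lt] : -1 < z < 1.
    by rewrite -ltr_norml -(@ltr_pXn2r _ 2) ?nnegrE// real_normK ?num_real ?expr1n.
  have zi : -1 <= z <= 1 by rewrite !ltW.
  have sE : r * sin (acos z) = y.
    rewrite sin_acos//; apply: (@pexpIrn _ 2) => //.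
    - by rewrite nnegrE mulr_ge0 ?sqrtr_ge0 ?ltW.
    - by rewrite nnegrE ltW.
    - by rewrite exprMn sqr_sqrtr ?ez// subr_ge0 ltW.
  have pE : circ_param xc ac bc (acos z) = (x, y).
    by rewrite /circ_param -/r sE acosK ?in_itv//= -xE.
  exists (acos z); last exact: pE.
  split; first by rewrite acos_gt0 ?acos_ltpi// ?z_gt ?z_lt ?andbT ltW.
  by rewrite pE; split=> //=; rewrite r2 real_normK ?num_real.
Qed.

Definition cap_willmore xc ac bc : \bar R :=
  revol_willmore (circ_param xc ac bc) (circ_dom xc ac bc).

Definition cap_density xc ac bc : \bar R :=
  revol_density (circ_param xc ac bc) (circ_dom xc ac bc).

End SphereCaps.

Section ComparisonCurves.
Context {R : realType}.
Local Open Scope complex_scope.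

Definition upper_half_plane : set R[i] := [set z | 0 < complex.Im z].

(* A pole would be sent to 0 by the division of the library; as M must map the
   open half plane onto itself, there is none in the half plane. *)
Definition half_plane_moebius (M : R[i] -> R[i]) : Prop :=
  exists a b c d : R[i],
    [/\ a * d - b * c != 0,
        (forall z, M z = (a * z + b) / (c * z + d)) \/
        (forall z, M z = (a * conjc z + b) / (c * conjc z + d)) &
        M @` upper_half_plane = upper_half_plane].

Definition to_complex (p : R * R) : R[i] := p.1 +i* p.2.

Definition catenary (s : R) : R[i] := s +i* ((expR s + expR (- s)) / 2).

Definition moebius_catenoid (C : set R[i]) : Prop :=
  exists2 M, half_plane_moebius M & C = range (M \o catenary).

(* The two end points on the axis are included. *)
Definition half_circle (a r : R) : set (R * R) :=
  [set p | 0 <= p.2 /\ (p.1 - a) ^+ 2 + p.2 ^+ 2 = r ^+ 2].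

(* R u {oo}; None stands for infinity. *)
Definition axis_point := option R.

(* [comparison_arc xc ac bc x c]: the restriction of c to [0, 1] is the curve
   from (xc, ac) with initial direction (cos bc, sin bc) to the point x of the
   axis.

   No regularity beyond continuity is asked at s = 1: an inverted catenary is
   not twice differentiable at its end point.

   The arc is immersed as long as it stays off the axis and stops as soon as
   it reaches x.  An arc of a half circle may reach the axis before: if the half
   circle through (xc, ac) in direction (cos bc, sin bc) starts in x, then the
   only arc ending in x first runs to the other end point and from there back
   along the whole half circle. *)
Definition comparison_arc (xc ac bc : R) (x : axis_point) (c : R -> R * R) :
    Prop :=
  let c1 := fst \o c in let c2 := snd \o c in
  let speed (s : R) := Num.sqrt (derive1 c1 s ^+ 2 + derive1 c2 s ^+ 2) in
  [/\ (forall n (s : R), 0 <= s < 1 ->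
         derivable (derive1n n c1) s 1 /\ derivable (derive1n n c2) s 1),
      (forall s : R, 0 <= s < 1 -> 0 <= c2 s) /\
      (forall s : R, 0 <= s < 1 -> 0 < c2 s -> speed s != 0),
      c 0 = (xc, ac) /\
      (derive1 c1 0 / speed 0, derive1 c2 0 / speed 0) =
        (cos bc, sin bc),
      match x with
      | Some x' => [/\ c 1 = (x', 0),
                       c s @[s --> 1^'-] --> c 1 &
                       forall s : R, 0 <= s < 1 -> c s <> (x', 0)]
      | None => Num.sqrt (c1 s ^+ 2 + c2 s ^+ 2) @[s --> 1^'-] --> +oo
      end &
      (exists2 C, moebius_catenoid C &
         forall s : R, 0 <= s < 1 -> C (to_complex (c s))) \/
      (exists a r : R, 0 < r /\ forall s : R, 0 <= s < 1 -> half_circle a r (c s))].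

End ComparisonCurves.

Section ClosedWillmoreEnergy.
Context {R : realType}.
Local Open Scope ereal_scope.

(* [gs] lists the pieces of the profile curve, each with its parameter set; the
   energy and the density of the surface are the sums of those of its pieces. *)
Definition willmore_closed (xm am bm xp ap bp : R)
    (gs : seq ((R -> R * R) * set R)) : \bar R :=
  \sum_(g <- gs) revol_willmore g.1 g.2
  + cap_willmore xm am bm + cap_willmore xp ap bp
  + (4 * pi)%:E * \sum_(g <- gs) revol_density g.1 g.2
  + (4 * pi)%:E * cap_density xm am bm
  + (4 * pi)%:E * cap_density xp ap bp.

Definition comparison_pair (xm am bm xp ap bp : R) (x : @axis_point R)
    (cm cp : R -> R * R) : Prop :=
  comparison_arc xm am bm x cm /\ comparison_arc xp ap bp x cp.

Definition comparison_energy (xm am bm xp ap bp : R) (cm cp : R -> R * R) :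
    \bar R :=
  willmore_closed xm am bm xp ap bp
    [:: (cm, `[0%R, 1%R[%classic); (cp, `[0%R, 1%R[%classic)].

Definition inf_comparison_energy (xm am bm xp ap bp : R) : \bar R :=
  ereal_inf [set w | exists x cm cp,
    comparison_pair xm am bm xp ap bp x cm cp /\
    w = comparison_energy xm am bm xp ap bp cm cp].

(* The fraction a (x - xc) / (a^2 + (x - xc)^2), read as 0 at infinity. *)
Definition axis_fraction (a xc : R) (x : @axis_point R) : R :=
  if x is Some x' then (a * (x' - xc) / (a ^+ 2 + (x' - xc) ^+ 2))%R else 0%R.

End ClosedWillmoreEnergy.

(* Main.v *)
Require Import Defs.
From mathcomp Require Import all_boot all_order all_algebra.
From mathcomp Require Import complex ring lra.
From mathcomp Require Import all_classical all_reals all_analysis measurable_realfun.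
Import Order.TTheory GRing.Theory Num.Theory.
Import numFieldNormedType.Exports.
Local Open Scope classical_set_scope.
Local Open Scope ring_scope.
Set Implicit Arguments.
Unset Strict Implicit.
Unset Printing Implicit Defensive.

(** On a surface of revolution curvature and area do not depend on the angle,
    so that the energy and the area in a ball are integrals over the parameter
    of the profile curve ([revol_willmoreE], [area_in_ballE]).  When the
    boundary direction is horizontal the caps are hemispheres, of energy 2 pi
    and density 0 ([cap_energy]).  Let an arc start at (xc, a) in the direction
    (d, 0), d = 1 or d = -1, and end at the point x of the axis; let W be the
    energy, D the density at infinity of its surface, and F the fraction
    a (x - xc) / (a^2 + (x - xc)^2).  The heart of the matter is
      W + 4 pi D = 4 pi - 4 pi d F                  ([comparison_arc_energy]).
    With d = 1 on the left and d = -1 on the right, both arcs and both caps add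
    up to 12 pi + 4 pi (F_right - F_left).

    A Moebius map of the half plane onto itself is real; it is a similarity or,
    up to similarities, an inversion.  An arc which is not on a half circle
    therefore lies on a dilated or on an inverted catenary
    ([moebius_catenoid_normal_form]).

    A dilated catenary is minimal, so that W = 0.  It stays away from the axis,
    hence the arc runs to infinity, where F = 0, and half a catenoid has
    density 1 there ([dilated_catenoid_energy]).

    Inversion carries both ends of the catenary to one point x0 of the axis, so
    that the arc ends in x0.  Along the catenary, parametrised by u, its energy
    is the increment of 4 pi T with
      T u = (u - m + sinh u cosh u) / ((u - m)^2 + cosh^2 u).
    This tends to 1 at the end of the arc, and equals d F at its start because
    the arc starts horizontally.  The area is finite, hence D = 0
    ([inverted_catenoid_energy]).

    On a half circle of radius a both principal curvatures are 1/a, and the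
    area element is 2 pi a |dx|, so that W is 2 pi / a times the total variation
    of the abscissa.  If the arc moves towards x, this variation is a.
    Otherwise the arc first reaches the other end of the half circle and then
    traverses all of it, and the variation is 3 a ([total_variation],
    [half_circle_energy]).

    For the lower limit, note that F_left and F_right lie in [-1/2, 1/2].  Now
    F_left is nearly 1/2 only for x at bounded distance from -1, where F_right
    tends to 0 as the right radius grows.  Hence F_right - F_left is
    asymptotically at least -1/2 ([fraction_difference]). *)

(** * Derivatives and zeros of functions of one variable *)

Section Calculus.
Context {R : realType}.
Implicit Types (f g df : R -> R) (a b s x : R).

Lemma is_derive_congr f s a b : is_derive s (1 : R) f a -> a = b ->
  is_derive s (1 : R) f b.
Proof. by move=> h <-. Qed.

Lemma is_derive_cstR a s : is_derive s (1 : R) (fun=> a) 0.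
Proof. exact: is_derive_cst. Qed.

Lemma is_derive_idR s : is_derive s (1 : R) (fun x => x) 1.
Proof. exact: is_derive_id. Qed.

Lemma is_derive_addR f g s a b : is_derive s (1 : R) f a ->
  is_derive s (1 : R) g b -> is_derive s (1 : R) (fun x => f x + g x) (a + b).
Proof. by move=> ? ?; exact: is_deriveD. Qed.

Lemma is_derive_oppR f s a : is_derive s (1 : R) f a ->
  is_derive s (1 : R) (fun x => - f x) (- a).
Proof. by move=> ?; exact: is_deriveN. Qed.

Lemma is_derive_mulR f g s a b : is_derive s (1 : R) f a ->
  is_derive s (1 : R) g b ->
  is_derive s (1 : R) (fun x => f x * g x) (a * g s + f s * b).
Proof.
move=> ? ?; have := @is_deriveM _ _ f g s 1 a b _ _.
by move=> h; apply: is_derive_eq; rewrite /GRing.scale/= addrC mulrC.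
Qed.

Lemma is_derive_sqrR f s a : is_derive s (1 : R) f a ->
  is_derive s (1 : R) (fun x => f x ^+ 2) (2 * f s * a).
Proof.
move=> df; rewrite (_ : (fun x => f x ^+ 2) = (fun x => f x * f x)).
  by apply: (is_derive_congr (is_derive_mulR df df)); lra.
by apply/funext => x; rewrite expr2.
Qed.

Lemma is_derive_invR f s a : is_derive s (1 : R) f a -> f s != 0 ->
  is_derive s (1 : R) (fun x => (f x)^-1) (- a / f s ^+ 2).
Proof.
move=> df f0; have h := is_deriveV f0 df.
by apply: (is_derive_congr h); rewrite /GRing.scale/=; field.
Qed.

Lemma is_derive_compR f g s a b : is_derive s (1 : R) g b ->
  is_derive (g s) (1 : R) f a -> is_derive s (1 : R) (fun x => f (g x)) (a * b).
Proof. by move=> dg df; exact: is_derive1_comp. Qed.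

Lemma is_derive_continuous f s a : is_derive s (1 : R) f a ->
  {for s, continuous f}.
Proof.
by move=> [df _]; apply: differentiable_continuous; exact/derivable1_diffP.
Qed.

Lemma is_derive_derive1 f s a : is_derive s (1 : R) f a -> derive1 f s = a.
Proof. by move=> [_ <-]; rewrite derive1E. Qed.

(** A two-sided derivative is a limit along the right neighbourhoods, so
    that functions which agree to the right of a point have the same derivative
    there. *)
Lemma is_derive_right_unique f g s e a b : s < e ->
  (forall x, s <= x < e -> f x = g x) ->
  is_derive s (1 : R) f a -> is_derive s (1 : R) g b -> a = b.
Proof.
move=> se fg [df <-] [dg <-].
have df' := cvg_dnbhs_at_right df; have dg' := cvg_dnbhs_at_right dg.
rewrite /derive; apply: (cvg_unique _ df').
  exact: norm_hausdorff.
apply: cvg_trans dg'; apply: near_eq_cvg.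
near=> h.
have h0 : 0 < h by near: h; exact: nbhs_right_gt.
have he : h < e - s by near: h; apply: nbhs_right_lt; lra.
by rewrite /= [h *: 1]mulr1 !fg//; lra.
Unshelve. all: end_near. Qed.

Lemma mean_value f df a b : a < b ->
  (forall x, a <= x <= b -> is_derive x (1 : R) f (df x)) ->
  exists2 c, a < c < b & f b - f a = df c * (b - a).
Proof.
move=> ab d; have [||c cab e] := @MVT _ f df a b ab.
- by move=> x; rewrite in_itv/= => /andP[? ?]; apply: d; rewrite !ltW.
- apply: derivable_within_continuous => x; rewrite in_itv/= => xab.
  by have [] := d x xab.
- by exists c.
Qed.

Lemma derive_gt0_lt f df a b : a < b ->
  (forall x, a <= x <= b -> is_derive x (1 : R) f (df x)) ->
  (forall x, a < x < b -> 0 < df x) -> f a < f b.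
Proof.
move=> ab d d0; have [c cab e] := mean_value ab d.
by rewrite -subr_gt0 e mulr_gt0 ?subr_gt0// d0.
Qed.

Lemma first_zero f a b : a < b ->
  (forall x, a <= x <= b -> {for x, continuous f}) -> 0 < f a -> f b <= 0 ->
  exists t, [/\ a < t <= b, f t = 0 & forall x, a <= x < t -> 0 < f x].
Proof.
move=> ab cf fa fb.
pose S := [set x | a <= x <= b /\ f x <= 0].
have Sb : S b by split=> //; rewrite lexx andbT ltW.
have lbS : lbound S a by move=> x [/andP[]].
have hiS : has_inf S by split; [exists b|exists a].
pose t := inf S.
have at_ : a <= t by apply: lb_le_inf => //; exists b.
have tb : t <= b by apply: ge_inf => //; exists a.
have pos x : a <= x < t -> 0 < f x.
  move=> /andP[ax xt]; rewrite ltNge; apply/negP => fx.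
  have : t <= x by apply: ge_inf; [exists a|split=> //; lra].
  lra.
have ft : f t <= 0.
  rewrite leNgt; apply/negP => ft.
  have ct : {for t, continuous f} by apply: cf; rewrite at_.
  have : \forall x \near t, 0 < f x by apply: (cvgr_gt _ ct).
  move=> /nbhs_ballP[e/= e0 be].
  have [x [xab fx] xe] := inf_adherent e0 hiS.
  have tx : t <= x by apply: ge_inf; [exists a|split].
  have := be x; rewrite /ball/= ltr_norml => /(_ _).
  rewrite (_ : - e < t - x < e); last by rewrite -/t in xe; lra.
  by move=> /(_ isT); lra.
have ta : a < t.
  rewrite lt_neqAle at_ andbT; apply/eqP => e; move: fa ft; rewrite -e; lra.
exists t; split=> //; first by rewrite ta.
apply/eqP; rewrite eq_le ft/= leNgt; apply/negP => ft0.
have ct : {for t, continuous f} by apply: cf; rewrite at_.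
have : \forall x \near t, f x < 0 by apply: (cvgr_lt _ ct).
move=> /nbhs_ballP[e/= e0 be].
pose x := Num.max a (t - e / 2).
have xt : x < t by rewrite /x gt_max ta/=; lra.
have ax : a <= x by rewrite /x le_max lexx.
have xe : t - e / 2 <= x by rewrite /x le_max lexx orbT.
have := be x; rewrite /ball/= ltr_norml (_ : - e < t - x < e); last by lra.
move=> /(_ isT); have := pos x; rewrite ax xt => /(_ isT); lra.
Qed.

Lemma last_zero f a b : a < b ->
  (forall x, a <= x <= b -> {for x, continuous f}) -> f a <= 0 -> 0 < f b ->
  exists t, [/\ a <= t < b, f t = 0 & forall x, t < x <= b -> 0 < f x].
Proof.
move=> ab cf fa fb.
have [||||t [tab ft tp]] := @first_zero (fun x => f (- x)) (- b) (- a).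
- by rewrite ltrN2.
- move=> x xab; apply: continuous_comp; first exact: opp_continuous.
  by apply: cf; lra.
- by rewrite opprK.
- by rewrite opprK.
exists (- t); split=> //; first by lra.
by move=> x xt; have := tp (- x); rewrite opprK; apply; lra.
Qed.

End Calculus.

(** * Improper integrals and rotation invariant integrals *)

Section RightOpenFTC.
Context {R : realType}.
Implicit Types (f F : R -> R) (a b l : R).
Local Notation mu := (@lebesgue_measure R).

Lemma continuous_within (D : set R) f :
  (forall x, D x -> {for x, continuous f}) -> {within D, continuous f}.
Proof.
by move=> cf; apply: continuous_in_subspaceT => x /set_mem Dx; exact: cf.
Qed.

Lemma continuous_measurable (D : set R) f : measurable D ->
  (forall x, D x -> {for x, continuous f}) -> measurable_fun D f.
Proof.
move=> mD cf; apply: subspace_continuous_measurable_fun => //.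
exact: continuous_within.
Qed.

Lemma FTC_closed f F a b : a < b ->
  (forall x, a <= x <= b -> {for x, continuous f}) ->
  (forall x, a <= x <= b -> is_derive x (1 : R) F (f x)) ->
  (\int[mu]_(x in `[a, b]) (f x)%:E)%E = (F b - F a)%:E.
Proof.
move=> ab cf dF; rewrite EFinB; apply: continuous_FTC2 => //.
- by apply: continuous_within => x /=; rewrite in_itv/=; exact: cf.
- have cF x : a <= x <= b -> {for x, continuous F}.
    by move=> /dF; exact: is_derive_continuous.
  split.
  + move=> x; rewrite in_itv/= => /andP[ax xb].
    by have [] := dF x; rewrite ?ltW.
  + by apply: cvg_at_right_filter; apply: cF; rewrite lexx ltW.
  + by apply: cvg_at_left_filter; apply: cF; rewrite lexx ltW.
- move=> x; rewrite in_itv/= => /andP[ax xb].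
  by apply: is_derive_derive1; apply: dF; rewrite !ltW.
Qed.

(** The integral over a half-open interval is the limit of the integrals over
    the compact intervals which exhaust it, whence an improper version of the
    fundamental theorem for nonnegative integrands. *)
Lemma FTC_right_open f F a b l : a < b ->
  (forall x, a <= x < b -> 0 <= f x) ->
  (forall x, a <= x < b -> {for x, continuous f}) ->
  (forall x, a <= x < b -> is_derive x (1 : R) F (f x)) ->
  F x @[x --> b^'-] --> l ->
  (\int[mu]_(x in `[a, b[) (f x)%:E)%E = (l - F a)%:E.
Proof.
move=> ab f0 cf dF Fl.
pose u n : R := b - (b - a) / n.+2%:R.
have u_lt n : u n < b by rewrite /u gtrBl divr_gt0 ?subr_gt0.
have u_gt n : a < u n.
  rewrite /u ltrBrDr -ltrBrDl ltr_pdivrMr// ltr_pMr ?subr_gt0//.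
  by rewrite ltr1n.
have u_nd : nondecreasing_seq u.
  move=> m n mn; apply: lerB => //; apply: ler_wpM2l; first by rewrite subr_ge0 ltW.
  by rewrite lef_pV2 ?posrE// ler_nat.
have u_cvg : u n @[n --> \oo] --> b.
  rewrite -[X in _ --> X]subr0 -(mulr0 (b - a)).
  apply: cvgB; first exact: cvg_cst.
  apply: cvgM; first exact: cvg_cst.
  by have := @cvg_harmonic R; rewrite -cvg_shiftS.
pose D n : set R := `[a, u n]%classic.
have DU : \bigcup_n D n = `[a, b[%classic.
  apply/seteqP; split=> x /=; rewrite /D/=.
    move=> [n _]/=; rewrite !in_itv/= => /andP[-> xu] /=.
    exact: le_lt_trans xu (u_lt n).
  rewrite in_itv/= => /andP[ax xb].
  have [n _ /(_ n (leqnn n)) /= hn] : \forall n \near \oo, x < u n.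
    exact: (cvgr_gt _ u_cvg).
  by exists n => //=; rewrite in_itv/= ax ltW.
have : (\int[mu]_(x in D n) (f x)%:E)%E @[n --> \oo] -->
    (\int[mu]_(x in `[a, b[) (f x)%:E)%E.
  rewrite -DU; apply: ge0_nondecreasing_set_cvg_integral.
  - move=> m n mn; rewrite subsetEset => x; rewrite /D/= !in_itv/=.
    by move=> /andP[-> /=] /le_trans; apply; exact: u_nd.
  - by move=> n; exact: measurable_itv.
  - move=> n; apply/measurable_EFinP; apply: continuous_measurable.
      exact: measurable_itv.
    move=> x; rewrite /D/= in_itv/= => /andP[ax xu].
    by apply: cf; rewrite ax (le_lt_trans xu).
  - move=> n x; rewrite /D/= in_itv/= => /andP[ax xu].
    by rewrite lee_fin f0// ax (le_lt_trans xu).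
have : (\int[mu]_(x in D n) (f x)%:E)%E @[n --> \oo] --> (l - F a)%:E.
  rewrite (_ : (fun n => _) = (fun n => (F (u n) - F a)%:E)); last first.
    apply/funext => n; apply: FTC_closed => // x /andP[ax xu].
      by apply: cf; rewrite ax (le_lt_trans xu).
    by apply: dF; rewrite ax (le_lt_trans xu).
  apply: cvg_EFin; first exact: nearW.
  apply: cvgB; last exact: cvg_cst.
  by have /cvg_at_leftP := Fl; apply.
by move=> /cvg_lim <-// /cvg_lim <-.
Qed.

End RightOpenFTC.

Section Revolution2D.
Context {R : realType}.
Local Notation mu := (@lebesgue_measure R).
Local Open Scope ereal_scope.

(** Tonelli's theorem: the angle contributes the factor 2 pi. *)
Lemma integral_rotation_invariant (K : set R) (h : R -> R)
    (f : R * R -> \bar R) : measurable K -> measurable_fun K h ->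
  (forall s, K s -> 0 <= h s)%R ->
  (forall p, K p.1 -> (0 <= p.2 < 2 * pi)%R -> f p = (h p.1)%:E) ->
  \int[leb2]_(p in [set p : R * R | K p.1 /\ (0 <= p.2 < 2 * pi)%R]) f p =
  (2 * pi)%:E * \int[mu]_(s in K) (h s)%:E.
Proof.
move=> mK mh h0 fh.
pose J : set R := `[0%R, (2 * pi)%R[%classic.
have mJ : measurable J by exact: measurable_itv.
have -> : [set p : R * R | K p.1 /\ (0 <= p.2 < 2 * pi)%R] = K `*` J.
  by apply/seteqP; split=> -[s t]/=; rewrite /J/= in_itv/=.
have muJ : mu J = (2 * pi)%:E.
  rewrite /J lebesgue_measure_itv/= lte_fin mulr_gt0 ?pi_gt0//=.
  by rewrite oppr0 adde0.
have mhK : measurable_fun setT ((EFin \o h) \_ K).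
  apply/(measurable_restrictT _ mK); exact/measurable_EFinP.
rewrite integral_mkcond.
have -> : f \_ (K `*` J) =
    fun p => ((EFin \o h) \_ K) p.1 * ((\1_J p.2)%:E).
  apply/funext => -[s t]; rewrite /patch/=.
  case: ifPn => [/set_mem[/= Ks Jt]|].
    have -> : f (s, t) = (h s)%:E.
      by apply: fh => //; move: Jt; rewrite /J/= in_itv.
    by rewrite (mem_set Ks) indicE (mem_set Jt) mule1.
  move=> /negP nst; case: ifPn => [/set_mem Ks|_]; last by rewrite mul0e.
  rewrite indicE; case: (boolP (t \in J)) => [/set_mem Jt|_].
    by exfalso; apply: nst; apply/mem_set.
  by rewrite mule0.
rewrite /leb2 fubini_tonelli1//; last 2 first.
- apply: emeasurable_funM.
    apply: (@measurableT_comp _ _ _ _ _ _ ((EFin \o h) \_ K) _ fst) => //.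
  apply/measurable_EFinP.
  have mJ1 : measurable_fun setT (\1_J : R -> R) by exact: measurable_indic.
  exact: (@measurableT_comp _ _ _ _ _ _ _ _ snd mJ1 measurable_snd).
- move=> [s t] /=; apply: mule_ge0; last by rewrite lee_fin.
  by rewrite /patch; case: ifPn => // /set_mem Ks; rewrite lee_fin h0.
transitivity (\int[mu]_s ((2 * pi)%:E * ((EFin \o h) \_ K) s)).
  apply: eq_integral => s _; rewrite /fubini_F/=.
  under eq_integral => t _ do rewrite muleC.
  have K0 : 0 <= ((EFin \o h) \_ K) s.
    by rewrite /patch; case: ifPn => // /set_mem Ks; rewrite lee_fin h0.
  rewrite ge0_integralZr//; last exact/measurable_EFinP/measurable_indic.
  rewrite integral_indic// setIT.
  by congr (_ * _); exact: muJ.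
rewrite ge0_integralZl//; last 2 first.
- move=> s _; rewrite /patch; case: ifPn => // /set_mem Ks.
  by rewrite lee_fin h0.
- by rewrite lee_fin mulr_ge0// pi_ge0.
by rewrite -integral_mkcond.
Qed.

End Revolution2D.

(** * Curvature and area of a surface of revolution *)

Section RevolutionGeometry.
Context {R : realType}.
Implicit Types (f a b : R -> R) (g : R -> R * R) (s t k : R).

(** No differentiability is needed, since both sides vanish when the difference
    quotient diverges: [lim] then has the default value 0.  The formulas for
    surfaces of revolution below thus hold without regularity hypotheses. *)
Lemma derive1_mulr f k s : derive1 (fun x => f x * k) s = derive1 f s * k.
Proof.
have [->|k0] := eqVneq k 0.
  rewrite mulr0 (_ : (fun x => f x * 0) = cst 0) ?derive1_cst//.
  by apply/funext => x /=; rewrite mulr0.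
have [df|ndf] := pselect (derivable f s 1).
  have d : is_derive s (1 : R) f (derive1 f s).
    by rewrite derive1E; exact/derivableP.
  have dk := is_derive_mulR d (is_derive_cstR k s).
  by rewrite (is_derive_derive1 dk) mulr0 addr0.
have ndk : ~ derivable (fun x => f x * k) s 1.
  move=> /derivableP dk; apply: ndf.
  have [+ _] := is_derive_mulR dk (is_derive_cstR k^-1 s).
  rewrite (_ : (fun x => f x * k * k^-1) = f)//.
  by apply/funext => x; rewrite mulfK.
by rewrite !derive1E /derive (dvgP ndf) (dvgP ndk) /point/= mul0r.
Qed.

Definition vec3 (x y z : R) : 'rV[R]_3 := \row_(i < 3) [:: x; y; z]`_i.

Lemma vec3_eta (v : 'rV[R]_3) x y z :
  v 0 0 = x -> v 0 1 = y -> v 0 2%:R = z -> v = vec3 x y z.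
Proof.
move=> vx vy vz; apply/rowP => i; rewrite mxE.
case: i => -[|[|[|//]]] i3 /=; rewrite -?vx -?vy -?vz;
  by congr (v 0 _); apply: val_inj.
Qed.

Lemma dot_vec3 x y z x' y' z' :
  dot (vec3 x y z) (vec3 x' y' z') = x * x' + y * y' + z * z'.
Proof. by rewrite /dot !big_ord_recr big_ord0 /= add0r !mxE. Qed.

Lemma cross_vec3 x y z x' y' z' : cross (vec3 x y z) (vec3 x' y' z') =
  vec3 (y * z' - z * y') (z * x' - x * z') (x * y' - y * x').
Proof. by apply: vec3_eta; rewrite /cross !mxE. Qed.

Lemma partial0_revol g s t : partial 0 (revol g) s t =
  vec3 (derive1 (fst \o g) s) (derive1 (snd \o g) s * cos t)
       (derive1 (snd \o g) s * sin t).
Proof.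
apply: vec3_eta; rewrite /partial mxE/=.
- by congr (derive1 _ _); apply/funext => x; rewrite /revol mxE.
- rewrite -derive1_mulr; congr (derive1 _ _).
  by apply/funext => x; rewrite /revol mxE.
- rewrite -derive1_mulr; congr (derive1 _ _).
  by apply/funext => x; rewrite /revol mxE.
Qed.

Lemma derive1_cos_mul k t : derive1 (fun x => k * cos x) t = k * - sin t.
Proof.
by apply: is_derive_derive1.
Qed.

Lemma derive1_sin_mul k t : derive1 (fun x => k * sin x) t = k * cos t.
Proof.
by apply: is_derive_derive1.
Qed.

Lemma partial1_revol g s t : partial 1 (revol g) s t =
  vec3 0 ((g s).2 * - sin t) ((g s).2 * cos t).
Proof.
apply: vec3_eta; rewrite /partial mxE/=.
- rewrite (_ : (fun x => _) = cst (g s).1) ?derive1_cst//.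
  by apply/funext => x; rewrite /revol mxE.
- rewrite -derive1_cos_mul; congr (derive1 _ _).
  by apply/funext => x; rewrite /revol mxE.
- rewrite -derive1_sin_mul; congr (derive1 _ _).
  by apply/funext => x; rewrite /revol mxE.
Qed.

Lemma partial00_revol g s t : partial 0 (partial 0 (revol g)) s t =
  vec3 (derive1 (derive1 (fst \o g)) s)
       (derive1 (derive1 (snd \o g)) s * cos t)
       (derive1 (derive1 (snd \o g)) s * sin t).
Proof.
rewrite -(partial0_revol (fun s => (derive1 (fst \o g) s, derive1 (snd \o g) s))).
by congr (partial 0 _ s t); apply/funext => x; apply/funext => u;
  rewrite partial0_revol.
Qed.

Lemma partial11_revol g s t : partial 1 (partial 1 (revol g)) s t =
  vec3 0 ((g s).2 * - cos t) ((g s).2 * - sin t).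
Proof.
apply: vec3_eta; rewrite [LHS]mxE/=.
- rewrite (_ : (fun x => _) = cst 0) ?derive1_cst//.
  by apply/funext => x; rewrite partial1_revol mxE.
- rewrite (_ : (fun x => _) = (fun x => - (g s).2 * sin x)); last first.
    by apply/funext => x; rewrite partial1_revol mxE/=; ring.
  by rewrite derive1_sin_mul; ring.
- rewrite -derive1_cos_mul; congr (derive1 _ _).
  by apply/funext => x; rewrite partial1_revol mxE.
Qed.

Definition speed g s : R :=
  Num.sqrt (derive1 (fst \o g) s ^+ 2 + derive1 (snd \o g) s ^+ 2).

(** The sum of the principal curvatures, of the meridian and of the parallel. *)
Definition mean_curvature g s : R :=
  (derive1 (derive1 (fst \o g)) s * derive1 (snd \o g) s -
   derive1 (derive1 (snd \o g)) s * derive1 (fst \o g) s) / speed g s ^+ 3 +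
  derive1 (fst \o g) s / ((g s).2 * speed g s).

Lemma speed_ge0 g s : 0 <= speed g s.
Proof. exact: sqrtr_ge0. Qed.

Lemma sqr_speed g s : speed g s ^+ 2 =
  derive1 (fst \o g) s ^+ 2 + derive1 (snd \o g) s ^+ 2.
Proof. by rewrite sqr_sqrtr// addr_ge0// sqr_ge0. Qed.

Lemma dot_partial0 g s t :
  dot (partial 0 (revol g) s t) (partial 0 (revol g) s t) = speed g s ^+ 2.
Proof.
rewrite partial0_revol dot_vec3 sqr_speed.
by ring: (sin2cos2 t).
Qed.

Lemma dot_partial1 g s t :
  dot (partial 1 (revol g) s t) (partial 1 (revol g) s t) = (g s).2 ^+ 2.
Proof.
rewrite partial1_revol dot_vec3.
by ring: (sin2cos2 t).
Qed.

Lemma dot_partial01 g s t :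
  dot (partial 0 (revol g) s t) (partial 1 (revol g) s t) = 0.
Proof. by rewrite partial0_revol partial1_revol dot_vec3; ring. Qed.

Lemma ord2P (i : 'I_2) : i = 0 \/ i = 1.
Proof. by case: i => -[|[|//]] i2; [left|right]; exact: val_inj. Qed.

Lemma first_form_revol g s t : first_form (revol g) s t =
  diag_mx (\row_(i < 2) [:: speed g s ^+ 2; (g s).2 ^+ 2]`_i).
Proof.
apply/matrixP => i j; rewrite !mxE.
case: (ord2P i) => ->; case: (ord2P j) => ->.
- by rewrite dot_partial0 eqxx mulr1n.
- by rewrite dot_partial01.
- by rewrite /dot; under eq_bigr do rewrite mulrC; exact: dot_partial01.
- by rewrite dot_partial1 eqxx mulr1n.
Qed.

Lemma area_density_revol g s t : 0 < (g s).2 ->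
  area_density (revol g) s t = (g s).2 * speed g s.
Proof.
move=> y0; rewrite /area_density first_form_revol det_diag.
rewrite !big_ord_recr big_ord0/= !mxE/= mul1r -exprMn sqrtr_sqr.
by rewrite ger0_norm 1?mulrC// mulr_ge0 ?speed_ge0// ltW.
Qed.

Lemma unit_normal_revol g s t : 0 < (g s).2 -> speed g s != 0 ->
  unit_normal (revol g) s t =
  vec3 (derive1 (snd \o g) s / speed g s)
       (- (derive1 (fst \o g) s * cos t) / speed g s)
       (- (derive1 (fst \o g) s * sin t) / speed g s).
Proof.
move=> y0 p0; rewrite /unit_normal partial0_revol partial1_revol cross_vec3.
have -> : vec3 (derive1 (snd \o g) s * cos t * ((g s).2 * cos t) -
    derive1 (snd \o g) s * sin t * ((g s).2 * - sin t))
    (derive1 (snd \o g) s * sin t * 0 -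
     derive1 (fst \o g) s * ((g s).2 * cos t))
    (derive1 (fst \o g) s * ((g s).2 * - sin t) -
     derive1 (snd \o g) s * cos t * 0) =
    vec3 ((g s).2 * derive1 (snd \o g) s)
      (- ((g s).2 * derive1 (fst \o g) s) * cos t)
      (- ((g s).2 * derive1 (fst \o g) s) * sin t).
  congr vec3; try by ring.
  by ring: (sin2cos2 t).
rewrite /enorm dot_vec3.
have -> : (g s).2 * derive1 (snd \o g) s * ((g s).2 * derive1 (snd \o g) s) +
   - ((g s).2 * derive1 (fst \o g) s) * cos t *
   (- ((g s).2 * derive1 (fst \o g) s) * cos t) +
   - ((g s).2 * derive1 (fst \o g) s) * sin t *
   (- ((g s).2 * derive1 (fst \o g) s) * sin t) =
   ((g s).2 * speed g s) ^+ 2.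
  by rewrite exprMn sqr_speed; ring: (sin2cos2 t).
rewrite sqrtr_sqr ger0_norm ?mulr_ge0 ?speed_ge0 1?ltW//.
have y1 := lt0r_neq0 y0.
by apply: vec3_eta; rewrite !mxE/=; field; rewrite p0 y1.
Qed.

Lemma trace_diag_inv (A : 'M[R]_2) (d : 'rV[R]_2) : d 0 0 != 0 -> d 0 1 != 0 ->
  \tr (A *m invmx (diag_mx d)) = A 0 0 / d 0 0 + A 1 1 / d 0 1.
Proof.
move=> d0 d1.
have inv : diag_mx d *m diag_mx (map_mx (fun x => x^-1) d) = 1%:M.
  rewrite mulmx_diag -diag_const_mx; congr diag_mx; apply/rowP => i.
  by rewrite !mxE mulfV//; case: (ord2P i) => ->.
have [uD _] := mulmx1_unit inv.
have -> : invmx (diag_mx d) = diag_mx (map_mx (fun x => x^-1) d).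
  by rewrite -[LHS]mulmx1 -inv mulmxA mulVmx// mul1mx.
rewrite /mxtrace !big_ord_recr big_ord0/= add0r mul_mx_diag !mxE.
by congr (A _ _ / d _ _ + A _ _ / d _ _); exact: val_inj.
Qed.

Lemma sum_principal_curvatures_revol g s t : 0 < (g s).2 -> speed g s != 0 ->
  sum_principal_curvatures (revol g) s t = mean_curvature g s.
Proof.
move=> y0 p0; have y1 := lt0r_neq0 y0.
rewrite /sum_principal_curvatures /weingarten first_form_revol.
rewrite trace_diag_inv; last 2 first.
- by rewrite mxE/= expf_neq0.
- by rewrite mxE/= expf_neq0.
rewrite /second_form !mxE/= partial00_revol partial11_revol unit_normal_revol//.
rewrite !dot_vec3 /mean_curvature.
set X1 := derive1 (fst \o g) s; set Y1 := derive1 (snd \o g) s.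
set p := speed g s in p0 *; set y := (g s).2 in y0 y1 *.
transitivity ((derive1 (derive1 (fst \o g)) s * Y1 -
    derive1 (derive1 (snd \o g)) s * X1 * (cos t ^+ 2 + sin t ^+ 2)) / p ^+ 3 +
    X1 * (cos t ^+ 2 + sin t ^+ 2) / (y * p)).
  clearbody X1 Y1 p y.
  move: (derive1 (derive1 (fst \o g)) s) (derive1 (derive1 (snd \o g)) s).
  by move: (cos t) (sin t) => C S X2 Y2; field; rewrite p0 y1.
by rewrite cos2Dsin2 !mulr1.
Qed.

End RevolutionGeometry.

(** * Energy and density at infinity as integrals along the profile curve *)

Section RevolutionIntegrals.
Context {R : realType}.
Local Notation mu := (@lebesgue_measure R).
Implicit Types (g : R -> R * R) (I : set R) (h : R -> R).

Definition off_axis g I : set R := [set s | I s /\ 0 < (g s).2].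

Lemma revol_domE g I : revol_dom g I =
  [set p : R * R | off_axis g I p.1 /\ 0 <= p.2 < 2 * pi].
Proof.
by apply/seteqP; split=> -[s t]; rewrite /revol_dom/off_axis/=;
  [move=> [? ? ?]|move=> [[? ?] ?]].
Qed.

Lemma willmore_density_ge0 g s : 0 < (g s).2 ->
  0 <= mean_curvature g s ^+ 2 * ((g s).2 * speed g s).
Proof.
move=> y0; apply: mulr_ge0; first exact: sqr_ge0.
by apply: mulr_ge0; [exact: ltW|exact: speed_ge0].
Qed.

Lemma revol_willmoreE g I h : measurable (off_axis g I) ->
  measurable_fun (off_axis g I) h ->
  (forall s, off_axis g I s -> speed g s != 0 /\
     mean_curvature g s ^+ 2 * ((g s).2 * speed g s) = h s) ->
  revol_willmore g I =
  ((pi / 2)%:E * \int[mu]_(s in off_axis g I) (h s)%:E)%E.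
Proof.
move=> mK mh hE; rewrite /revol_willmore /willmore revol_domE.
have h0 s : off_axis g I s -> 0 <= h s.
  by move=> Ks; rewrite -(hE s Ks).2; apply: willmore_density_ge0; case: Ks.
rewrite (integral_rotation_invariant mK mh)//.
  rewrite muleA -EFinM; congr (_%:E * _)%E; by field.
move=> p Kp tp; have [_ y0] := Kp; have [p0 <-] := hE _ Kp.
by rewrite sum_principal_curvatures_revol// area_density_revol.
Qed.

Lemma enorm_revol g s t :
  enorm (revol g s t) = Num.sqrt ((g s).1 ^+ 2 + (g s).2 ^+ 2).
Proof.
rewrite /enorm (_ : revol g s t =
  vec3 (g s).1 ((g s).2 * cos t) ((g s).2 * sin t))// dot_vec3.
by congr Num.sqrt; ring: (sin2cos2 t).
Qed.

Definition in_ball g (r : R) : set R :=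
  [set s | Num.sqrt ((g s).1 ^+ 2 + (g s).2 ^+ 2) < r].

Lemma area_in_ballE g I h r : measurable (off_axis g I) ->
  measurable (off_axis g I `&` in_ball g r) ->
  measurable_fun (off_axis g I) h ->
  (forall s, off_axis g I s -> (g s).2 * speed g s = h s) ->
  area_in_ball (revol g) (revol_dom g I) r =
  ((2 * pi)%:E * \int[mu]_(s in off_axis g I `&` in_ball g r) (h s)%:E)%E.
Proof.
move=> mK mKr mh hE; rewrite /area_in_ball.
rewrite (_ : _ `&` _ = [set p : R * R |
  (off_axis g I `&` in_ball g r) p.1 /\ 0 <= p.2 < 2 * pi]); last first.
  rewrite revol_domE; apply/seteqP; split=> -[s t]/=; rewrite enorm_revol.
    by move=> [[? ?] ?].
  by move=> [[? ?] ?].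
apply: integral_rotation_invariant => //.
- exact: measurable_funS mK (@subIsetl _ _ _) mh.
- move=> s [Ks _]; rewrite -hE// mulr_ge0 ?speed_ge0//.
  by case: Ks => _ /ltW.
- move=> p [Kp _] _; rewrite area_density_revol ?hE//; by case: Kp.
Qed.

Lemma density_limit (a : R -> \bar R) (l : R) :
  (forall e, 0 < e -> exists r0, forall r, r0 < r ->
     (((l - e) * (pi * r ^+ 2))%:E <= a r <=
      ((l + e) * (pi * r ^+ 2))%:E)%E) ->
  lim ((a r * ((pi * r ^+ 2)^-1)%:E)%E @[r --> +oo]) = l%:E.
Proof.
move=> al; apply/cvg_lim => //.
have fin r b c : (b%:E <= a r <= c%:E)%E -> a r \is a fin_num.
  move=> /andP[ba ac]; rewrite fin_numE; apply/andP; split.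
    by rewrite gt_eqF// (lt_le_trans _ ba)// ltNyr.
  by rewrite lt_eqF// (le_lt_trans ac)// ltry.
suff H : (fun r : R => fine (a r * ((pi * r ^+ 2)^-1)%:E)%E) r @[r --> +oo]
    --> l.
  apply: cvg_EFin => //.
  have [r0 hr0] := al 1 ltr01.
  near=> r; rewrite fin_numM//; apply: fin (hr0 r _).
  by near: r; apply: nbhs_pinfty_gt; exact: num_real.
apply/cvgrPdist_le => e e0; have [r0 hr0] := al e e0.
near=> r => /=.
have /[dup] /fin fa : (((l - e) * (pi * r ^+ 2))%:E <= a r <=
      ((l + e) * (pi * r ^+ 2))%:E)%E.
  by apply: hr0; near: r; apply: nbhs_pinfty_gt; exact: num_real.
have r_gt0 : 0 < r by near: r; apply: nbhs_pinfty_gt; exact: num_real.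
have c_gt0 : 0 < pi * r ^+ 2 by rewrite mulr_gt0 ?pi_gt0// exprn_gt0.
rewrite -(fineK fa) !lee_fin => /andP[h1 h2].
rewrite -EFinM/= ler_norml.
have q1 : l - e <= fine (a r) / (pi * r ^+ 2) by rewrite ler_pdivlMr.
have q2 : fine (a r) / (pi * r ^+ 2) <= l + e by rewrite ler_pdivrMr.
by lra.
Unshelve. all: end_near. Qed.


Section Continuous.
Variables (g : R -> R * R) (I : set R).
Hypotheses (mI : measurable I).
Hypothesis cg1 : forall s, I s -> {for s, continuous (fst \o g)}.
Hypothesis cg2 : forall s, I s -> {for s, continuous (snd \o g)}.

Lemma measurable_off_axis : measurable (off_axis g I).
Proof.
have m2 := continuous_measurable mI cg2.
have := m2 mI _ (measurable_itv `]0, +oo[).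
rewrite (_ : _ `&` _ = off_axis g I)//.
by apply/seteqP; split=> s [Is]; rewrite /= in_itv/= andbT.
Qed.

Lemma measurable_in_ball r : measurable (off_axis g I `&` in_ball g r).
Proof.
pose n s := Num.sqrt ((g s).1 ^+ 2 + (g s).2 ^+ 2).
have mn : measurable_fun I n.
  apply: continuous_measurable => // s Is.
  apply: (@continuous_comp _ _ _ (fun s => (g s).1 ^+ 2 + (g s).2 ^+ 2)
    Num.sqrt); last exact: sqrt_continuous.
  apply: cvgD; rewrite /=.
  - by under eq_fun do rewrite expr2; rewrite expr2; apply: cvgM; exact: cg1.
  - by under eq_fun do rewrite expr2; rewrite expr2; apply: cvgM; exact: cg2.
have := mn mI _ (measurable_itv `]-oo, r[).
move=> /(measurableI _ _ measurable_off_axis).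
rewrite (_ : _ `&` _ = off_axis g I `&` in_ball g r)//.
apply/seteqP; split=> s; rewrite /= in_itv/=.
  by move=> [Ks [_ ns]].
by move=> [[Is y0] ns].
Qed.

Lemma density_finite_area h (A : R) :
  measurable_fun (off_axis g I) h ->
  (forall s, off_axis g I s -> (g s).2 * speed g s = h s) ->
  (\int[mu]_(s in off_axis g I) (h s)%:E <= A%:E)%E ->
  revol_density g I = 0%:E.
Proof.
move=> mh hE hA; have mK := measurable_off_axis.
have h0 s : off_axis g I s -> 0 <= h s.
  move=> Ks; rewrite -hE//; apply: mulr_ge0; last exact: speed_ge0.
  by case: Ks => _ /ltW.
apply: density_limit => e e0; exists (Num.max 1 (2 * A / e)) => r.
rewrite gt_max => /andP[r1 rA].
have rr : r <= r ^+ 2 by rewrite expr2 ler_pMl//; [exact: ltW|lra].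
have pr : 0 < pi * r ^+ 2 by rewrite mulr_gt0 ?pi_gt0// exprn_gt0//; lra.
rewrite (area_in_ballE mK (measurable_in_ball r) mh hE); apply/andP; split.
  apply: (@le_trans _ _ 0%E).
    by rewrite lee_fin sub0r mulNr oppr_le0 ltW// mulr_gt0.
  apply: mule_ge0; first by rewrite lee_fin mulr_ge0// pi_ge0.
  by apply: integral_ge0 => s [Ks _]; rewrite lee_fin h0.
apply: (@le_trans _ _ ((2 * pi)%:E * A%:E)%E).
  apply: lee_pmul.
  - by rewrite lee_fin mulr_ge0// pi_ge0.
  - by apply: integral_ge0 => s [Ks _]; rewrite lee_fin h0.
  - by [].
  - apply: le_trans hA; apply: ge0_subset_integral => //.
    + exact: measurable_in_ball.
    + exact/measurable_EFinP.
rewrite lee_fin add0r.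
have {}rA : 2 * A <= e * r ^+ 2.
  by rewrite -ler_pdivrMl// mulrC (le_trans (ltW rA)).
have := ler_wpM2l (pi_ge0 R) rA; lra.
Qed.

End Continuous.

End RevolutionIntegrals.

(** * Total variation of the abscissa along a half circle *)

Section TotalVariation.
Context {R : realType}.
Local Notation mu := (@lebesgue_measure R).
Variables (Z z1 : R -> R) (r e : R).
Implicit Types s t a b x : R.
Hypothesis r0 : 0 < r.
Hypothesis e1 : e = 1 \/ e = -1.
Hypothesis dZ : forall s, 0 <= s < 1 -> is_derive s (1 : R) Z (z1 s).
Hypothesis cz1 : forall s, 0 <= s < 1 -> {for s, continuous z1}.
Hypothesis Zr : forall s, 0 <= s < 1 -> Z s ^+ 2 <= r ^+ 2.
Hypothesis z1N0 : forall s, 0 <= s < 1 -> Z s ^+ 2 < r ^+ 2 -> z1 s != 0.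
Hypothesis z10 : forall s, 0 <= s < 1 -> Z s ^+ 2 = r ^+ 2 -> z1 s = 0.
Hypotheses (Z0 : Z 0 = 0) (z1_0 : 0 < z1 0).
Hypothesis Z1 : Z s @[s --> 1^'-] --> e * r.
Hypothesis Ze : forall s, 0 <= s < 1 -> Z s <> e * r.

Let W s := r ^+ 2 - Z s ^+ 2.

Let W0 : 0 < W 0.
Proof. by rewrite /W Z0 expr0n subr0 exprn_gt0. Qed.

Let cW s : 0 <= s < 1 -> {for s, continuous W}.
Proof.
move=> s01; apply: is_derive_continuous.
exact: (is_derive_addR (is_derive_cstR (r ^+ 2) s)
  (is_derive_oppR (is_derive_sqrR (dZ s01)))).
Qed.

Let z1_gt0 t : t <= 1 -> (forall s, 0 <= s < t -> 0 < W s) ->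
  forall s, 0 <= s < t -> 0 < z1 s.
Proof.
move=> t1 Wt s /andP[s0 st]; rewrite ltNge; apply/negP => z1s.
have sn0 : 0 < s.
  rewrite lt_neqAle s0 andbT; apply/eqP => s00.
  by move: z1s; rewrite -s00 leNgt z1_0.
have [||//|//|t' [t's t'0 _]] := @first_zero _ z1 0 s; first by [].
  by move=> x x0s; apply: cz1; lra.
have Wt' := Wt t' ltac:(lra).
have /eqP := z1N0 (s := t') ltac:(lra) ltac:(rewrite /W in Wt'; lra).
by [].
Qed.

Let Zincr t a b : t <= 1 -> (forall s, 0 <= s < t -> 0 < W s) ->
  0 <= a -> a < b -> b <= t -> b < 1 -> Z a < Z b.
Proof.
move=> t1 Wt a0 ab bt b1; apply: (@derive_gt0_lt _ _ z1) => //.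
  by move=> x xab; apply: dZ; lra.
by move=> x xab; apply: (z1_gt0 t1 Wt); lra.
Qed.

Let Z_eq s : Z s ^+ 2 = r ^+ 2 -> Z s = r \/ Z s = - r.
Proof. by move=> /eqP; rewrite eqf_sqr => /orP[] /eqP; [left|right]. Qed.

Let mz1 (a b : R) : 0 <= a -> b <= 1 ->
  measurable_fun `[a, b[ (fun s => `|z1 s|).
Proof.
move=> a0 b1; apply: continuous_measurable; first exact: measurable_itv.
move=> x; rewrite /= in_itv/= => xab; apply: (@continuous_comp _ _ _ z1).
  by apply: cz1; lra.
exact: norm_continuous.
Qed.

Let increasing_part T : 0 < T <= 1 -> (forall s, 0 <= s < T -> 0 < W s) ->
  Z s @[s --> T^'-] --> r -> (\int[mu]_(s in `[0%R, T[) (`|z1 s|)%:E = r%:E)%E.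
Proof.
move=> /andP[T0 T1] WT ZT.
have -> : r%:E = (r - Z 0)%:E by rewrite Z0 subr0.
apply: FTC_right_open => //.
- move=> x x0T; apply: (@continuous_comp _ _ _ z1).
    by apply: cz1; lra.
  exact: norm_continuous.
- move=> x x0T; apply: (is_derive_congr (dZ _)); first by lra.
  by rewrite gtr0_norm//; apply: z1_gt0 x0T.
Qed.

(** The function rises from 0 to r; if it is to end at -r, then it cannot meet
    that value before, so that it descends from r to -r without turning back. *)
Lemma total_variation :
  (\int[mu]_(s in `[0%R, 1%R[) (`|z1 s|)%:E = ((2 - e) * r)%:E)%E.
Proof.
have [WW|nW] := pselect (forall s, 0 <= s < 1 -> 0 < W s).
  case: e1 => ee.
    rewrite (increasing_part _ WW); last 2 first.
    - by rewrite ltr01 lexx.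
    - by move: Z1; rewrite ee mul1r.
    by congr EFin; rewrite ee; lra.
  have : 0 <= e * r.
    rewrite -(cvg_lim _ Z1)//; apply: limr_ge.
      by apply/cvg_ex; exists (e * r).
    near=> s.
    have s0 : 0 < s by near: s; apply: nbhs_left_gt.
    have s1 : s < 1 by near: s; apply: nbhs_left_lt.
    by rewrite -Z0; apply/ltW/(Zincr (lexx 1) WW); lra.
  by rewrite ee mulN1r oppr_ge0 leNgt r0.
have {nW} [s0 s01 Ws0] : exists2 s, 0 <= s < 1 & W s <= 0.
  apply: contrapT => h; apply: nW => s s01; rewrite ltNge; apply/negP => Ws.
  by apply: h; exists s.
have s0_gt0 : 0 < s0.
  rewrite lt_neqAle (andP s01).1 andbT; apply/eqP => s00.
  by move: Ws0; rewrite -s00 leNgt W0.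
have [||//|//|T [T0 WT0 WT]] := @first_zero _ W 0 s0; first by [].
  by move=> x x0; apply: cW; lra.
have T1 : T < 1 by lra.
have ZT : Z T = r.
  have : 0 < Z T by rewrite -Z0; apply: (Zincr _ WT); lra.
  have [//|->] : Z T = r \/ Z T = - r by apply: Z_eq; rewrite /W in WT0; lra.
  by rewrite oppr_gt0 ltNge ltW.
have ee : e = -1.
  by case: e1 => // ee; exfalso; apply: (Ze (s := T)); [lra|rewrite ee mul1r].
have z1_le0 s : T <= s < 1 -> z1 s <= 0.
  move=> /andP[Ts s1]; rewrite leNgt; apply/negP => z1s.
  have [sT|sT] := eqVneq s T.
    by move: z1s; rewrite z10 ?ltxx//; [lra|rewrite sT ZT].
  have {Ts sT} Ts : T < s by rewrite lt_neqAle eq_sym sT.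
  have Ws : 0 < W s.
    have := Zr (s := s) ltac:(lra); rewrite le_eqVlt => /orP[/eqP Zs|].
      by move: z1s; rewrite z10 ?ltxx//; lra.
    by rewrite /W subr_gt0.
  have [||||t [Tt Wt0 Wt]] := @last_zero _ W T s => //.
    by move=> x x0; apply: cW; lra.
  by rewrite WT0.
  have z1t x : t < x <= s -> 0 < z1 x.
    move=> /andP[tx xs]; rewrite ltNge; apply/negP => z1x.
    have xs' : x < s.
      rewrite lt_neqAle xs andbT; apply/eqP => xs'.
      by move: z1s z1x; rewrite -xs' ltNge => /negP.
    have [||//|//|t' [t's t'0 _]] := @last_zero _ z1 x s; first by [].
      by move=> y y0; apply: cz1; lra.
    have Wt' := Wt t' ltac:(lra).
    have /eqP := z1N0 (s := t') ltac:(lra) ltac:(rewrite /W in Wt'; lra).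
    by [].
  have Zts : Z t < Z s.
    apply: (@derive_gt0_lt _ _ z1); first by lra.
      by move=> x xts; apply: dZ; lra.
    by move=> x xts; apply: z1t; lra.
  have Zs_lt : Z s <= r.
    have := Zr (s := s) ltac:(lra).
    by move=> Zs2; rewrite leNgt; apply/negP => rZ; have r_gt0 := r0; nra.
  have [Zt|Zt] : Z t = r \/ Z t = - r by apply: Z_eq; rewrite /W in Wt0; lra.
    by lra.
  by apply: (Ze (s := t)); [lra|rewrite Zt ee mulN1r].
have U01 : `[0%R, 1%R[%classic = `[0%R, T[%classic `|` `[T, 1%R[%classic :> set R.
  by apply: itv_bndbnd_setU; rewrite bnd_simp; lra.
rewrite U01 ge0_integral_setU//=; last 2 first.
- by rewrite -U01; apply/measurable_EFinP; exact: mz1.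
- apply/disj_setPS => x [] /=; rewrite !in_itv/= => ? ?; lra.
rewrite (increasing_part _ WT); last 2 first.
- by lra.
- have T01 : 0 <= T < 1 by lra.
  have /cvg_at_left_filter := is_derive_continuous (dZ T01).
  by rewrite ZT.
have -> : ((2 - e) * r)%:E = (r%:E + (r - - Z T)%:E)%E.
  by rewrite -EFinD; congr EFin; rewrite ZT ee; lra.
congr (_ + _)%E; apply: (@FTC_right_open _ _ (fun s => - Z s)) => //.
- move=> x x0T; apply: (@continuous_comp _ _ _ z1).
    by apply: cz1; lra.
  exact: norm_continuous.
- move=> x x0T; have zx := z1_le0 x x0T.
  apply: (is_derive_congr (is_derive_oppR (dZ _))); first by lra.
  by rewrite ler0_norm.
- by rewrite -(opprK r); apply: cvgN; move: Z1; rewrite ee mulN1r.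
Unshelve. all: end_near. Qed.

End TotalVariation.

(** * Arcs of half circles *)

Section Arcs.
Context {R : realType}.
Local Notation mu := (@lebesgue_measure R).
Implicit Types (c : R -> R * R) (s : R).

(** Two derivatives enter the curvature.  They are two-sided at 0 as well, where
    the arc is a restriction of a curve defined on both sides. *)
Definition twice_derivable c := forall s, 0 <= s < 1 ->
  [/\ is_derive s (1 : R) (fst \o c) (derive1 (fst \o c) s),
      is_derive s (1 : R) (snd \o c) (derive1 (snd \o c) s),
      is_derive s (1 : R) (derive1 (fst \o c)) (derive1 (derive1 (fst \o c)) s) &
      is_derive s (1 : R) (derive1 (snd \o c)) (derive1 (derive1 (snd \o c)) s)].

Lemma derivable_is_derive (f : R -> R) s :
  derivable f s 1 -> is_derive s (1 : R) f (derive1 f s).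
Proof. by move=> df; rewrite derive1E; exact/derivableP. Qed.

(** Relations satisfied along an arc may be differentiated, also at the left end
    point, as right neighbourhoods suffice. *)
Lemma is_derive_arc_unique (f g : R -> R) s (a b : R) : 0 <= s < 1 ->
  (forall u, 0 <= u < 1 -> f u = g u) ->
  is_derive s (1 : R) f a -> is_derive s (1 : R) g b -> a = b.
Proof.
move=> /andP[s0 s1] fg; apply: (is_derive_right_unique s1).
by move=> u /andP[su u1]; apply: fg; rewrite u1 (le_trans s0).
Qed.

Section TwiceDerivable.
Variable c : R -> R * R.
Hypothesis dc : twice_derivable c.

Lemma measurable_off_axis_arc : measurable (off_axis c `[0, 1[).
Proof.
apply: measurable_off_axis; first exact: measurable_itv.
by move=> s; rewrite /= in_itv/= => /dc[_ /is_derive_continuous].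
Qed.

Lemma density_finite_area_arc h (A : R) :
  measurable_fun (off_axis c `[0, 1[) h ->
  (forall s, off_axis c `[0, 1[ s -> (c s).2 * speed c s = h s) ->
  (\int[mu]_(s in off_axis c `[0%R, 1%R[) (h s)%:E <= A%:E)%E ->
  revol_density c `[0, 1[ = 0%:E.
Proof.
apply: density_finite_area; first exact: measurable_itv.
  by move=> s; rewrite /= in_itv/= => /dc[/is_derive_continuous].
by move=> s; rewrite /= in_itv/= => /dc[_ /is_derive_continuous].
Qed.

End TwiceDerivable.

(** The energy and the density at infinity of a piece separately depend on the
    kind of the piece; their combination does not. *)
Definition arc_energy (xc a d : R) (x : @axis_point R) c : Prop :=
  exists W D : R, [/\ revol_willmore c `[0, 1[ = W%:E,
    revol_density c `[0, 1[ = D%:E &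
    W + 4 * pi * D = 4 * pi - 4 * pi * (d * axis_fraction a xc x)].

Section HalfCircle.
Variables (xc a d xe : R) (c : R -> R * R).
Let X := fst \o c.
Let Y := snd \o c.
Let x1 := derive1 X.
Let y1 := derive1 Y.
Hypotheses (a0 : 0 < a) (d1 : d = 1 \/ d = -1).
Hypothesis dc : twice_derivable c.
Hypothesis Y0 : forall s, 0 <= s < 1 -> 0 <= Y s.
Hypothesis imm : forall s, 0 <= s < 1 -> 0 < Y s -> speed c s != 0.
Hypothesis c0 : c 0 = (xc, a).
Hypothesis x10 : x1 0 = d * speed c 0.
Hypothesis cxe : c s @[s --> 1^'-] --> (xe, 0 : R).
Hypothesis cNxe : forall s, 0 <= s < 1 -> c s <> (xe, 0).
Hypothesis circ : forall s, 0 <= s < 1 -> (X s - xc) ^+ 2 + Y s ^+ 2 = a ^+ 2.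

Let orth s : 0 <= s < 1 -> (X s - xc) * x1 s + Y s * y1 s = 0.
Proof.
move=> s01; have [dX dY _ _] := dc s01.
have dXx := is_derive_addR dX (is_derive_cstR (- xc) s).
have := is_derive_arc_unique s01 circ
  (is_derive_addR (is_derive_sqrR dXx) (is_derive_sqrR dY))
  (is_derive_cstR (a ^+ 2) s).
by rewrite -/X -/Y -/x1 -/y1; lra.
Qed.

Let orth2 s : 0 <= s < 1 -> x1 s ^+ 2 + (X s - xc) * derive1 x1 s +
  (y1 s ^+ 2 + Y s * derive1 y1 s) = 0.
Proof.
move=> s01; have [dX dY dX1 dY1] := dc s01.
have dXx := is_derive_addR dX (is_derive_cstR (- xc) s).
have := is_derive_arc_unique s01 orth
  (is_derive_addR (is_derive_mulR dXx dX1) (is_derive_mulR dY dY1))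
  (is_derive_cstR 0 s).
rewrite -/X -/Y -/x1 -/y1; move: (derive1 x1 s) (derive1 y1 s) (x1 s) (y1 s).
by move: (X s) (Y s) => p q x2 y2 u v; lra.
Qed.

Let sp s : speed c s ^+ 2 = x1 s ^+ 2 + y1 s ^+ 2.
Proof. exact: sqr_speed. Qed.

(* The tangent is orthogonal to the radius, whose horizontal and vertical
   components are x - xc and y. *)
Let area_circle s : 0 <= s < 1 -> Y s * speed c s = a * `|x1 s|.
Proof.
move=> s01; apply: (@pexpIrn _ 2) => //.
- by rewrite nnegrE mulr_ge0 ?speed_ge0 ?Y0.
- by rewrite nnegrE mulr_ge0// ltW.
rewrite !exprMn sp real_normK ?num_real// -(circ s01).
have o : Y s * y1 s = - ((X s - xc) * x1 s) by have := orth s01; lra.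
by rewrite [LHS]mulrDr -(exprMn 2 _ (y1 s)) o; ring.
Qed.

Let x1N0 s : 0 <= s < 1 -> 0 < Y s -> x1 s != 0.
Proof.
move=> s01 y0; apply/eqP => x10'; have := area_circle s01.
rewrite x10' normr0 mulr0 => /eqP; rewrite mulf_eq0 (negbTE (imm s01 y0)) orbF.
by rewrite (gt_eqF y0).
Qed.

Let x1E0 s : 0 <= s < 1 -> Y s = 0 -> x1 s = 0.
Proof.
move=> s01 y0; have := circ s01; have := orth s01.
rewrite y0 mul0r addr0 expr0n/= addr0 => /eqP; rewrite mulf_eq0.
case/orP => [/eqP ->|/eqP //]; rewrite expr0n/= => /esym/eqP.
by rewrite expf_eq0/= (gt_eqF a0).
Qed.

Let curvature_circle s : 0 <= s < 1 -> 0 < Y s ->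
  mean_curvature c s ^+ 2 * (Y s * speed c s) = 4 / a * `|x1 s|.
Proof.
move=> s01 y0; have p0 := imm s01 y0; have yN0 := lt0r_neq0 y0.
have H : mean_curvature c s = 2 * x1 s / (Y s * speed c s).
  have k : derive1 x1 s * y1 s - derive1 y1 s * x1 s =
      x1 s * speed c s ^+ 2 / Y s.
    apply: (mulfI yN0); rewrite mulrCA divff// mulr1 sp.
    have o : Y s * y1 s = - ((X s - xc) * x1 s) by have := orth s01; lra.
    have o2 : Y s * derive1 y1 s =
        - (x1 s ^+ 2 + (X s - xc) * derive1 x1 s + y1 s ^+ 2).
      have := orth2 s01; move: (derive1 x1 s) (derive1 y1 s) (x1 s) (y1 s).
      by move: (X s) (Y s) => p q x2 y2 u v; lra.
    rewrite mulrBr (mulrCA _ (derive1 x1 s)) o (mulrA (Y s)) o2; ring.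
  by rewrite /mean_curvature -/X -/Y -/x1 -/y1 k; field; rewrite p0.
have nx : `|x1 s| != 0 by rewrite normr_eq0 x1N0.
have a1 := lt0r_neq0 a0.
rewrite H area_circle// !exprMn exprVn.
have -> : x1 s ^+ 2 = `|x1 s| ^+ 2 by rewrite real_normK ?num_real.
by field; rewrite nx a1.
Qed.

Let off s : off_axis c `[0, 1[ s -> 0 <= s < 1 /\ 0 < Y s.
Proof. by move=> []; rewrite /= in_itv/=. Qed.

Let cx1 s : 0 <= s < 1 -> {for s, continuous x1}.
Proof. by move=> /dc[_ _ /is_derive_continuous]. Qed.

Let cabs s : 0 <= s < 1 -> {for s, continuous (fun s => `|x1 s|)}.
Proof.
move=> s01; apply: (@continuous_comp _ _ _ x1); first exact: cx1.
exact: norm_continuous.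
Qed.

Let X_cvg : X s @[s --> 1^'-] --> xe.
Proof. by apply: (cvg_comp _ _ cxe); exact: cvg_fst. Qed.

Let Y_cvg : Y s @[s --> 1^'-] --> 0.
Proof. by apply: (cvg_comp _ _ cxe); exact: cvg_snd. Qed.

Let end_circle : (xe - xc) ^+ 2 = a ^+ 2.
Proof.
have : (X s - xc) ^+ 2 + Y s ^+ 2 @[s --> 1^'-] --> (xe - xc) ^+ 2 + 0 ^+ 2.
  rewrite !expr2; under eq_fun do rewrite !expr2.
  apply: cvgD; last by apply: cvgM.
  by apply: cvgM; apply: cvgB => //; exact: cvg_cst.
have : (X s - xc) ^+ 2 + Y s ^+ 2 @[s --> 1^'-] --> a ^+ 2.
  apply: (@cvg_trans _ ((fun=> a ^+ 2) @ (1 : R)^'-)); last exact: cvg_cst.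
  apply: near_eq_cvg; near=> s.
  have s0 : 0 < s by near: s; apply: nbhs_left_gt.
  have s1 : s < 1 by near: s; apply: nbhs_left_lt.
  by rewrite circ//; lra.
by move=> h1 h2; rewrite -(cvg_lim _ h1)// (cvg_lim _ h2)// expr0n addr0.
Unshelve. all: end_near. Qed.

(** The sign e says whether the arc ends on the side to which it sets out. *)
Lemma half_circle_energy : arc_energy xc a d (Some xe) c.
Proof.
have dd : d * d = 1 by case: d1 => ->; lra.
pose e := d * (xe - xc) / a.
have aN0 := lt0r_neq0 a0.
have xeE : xe - xc = d * (e * a) by rewrite /e divfK// mulrA dd mul1r.
have e1 : e = 1 \/ e = -1.
  have : e ^+ 2 = 1 ^+ 2.
    rewrite /e !exprMn exprVn end_circle expr2 dd.
    by rewrite mul1r expr1n divff// expf_neq0.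
  by move=> /eqP; rewrite eqf_sqr => /orP[] /eqP; [left|right].
pose K := off_axis c `[0, 1[%classic.
have mK : measurable K by exact: measurable_off_axis_arc.
have mx1 : measurable_fun K (fun s => `|x1 s|).
  by apply: continuous_measurable => // s /off[s01 _]; exact: cabs.
have var : (\int[mu]_(s in K) `|x1 s|%:E = ((2 - e) * a)%:E)%E.
  transitivity (\int[mu]_(s in `[0%R, 1%R[) `|d * x1 s|%:E)%E.
    rewrite integral_mkcond [RHS]integral_mkcond; apply: eq_integral => s _.
    have nd : `|d * x1 s| = `|x1 s|.
      by rewrite normrM; case: d1 => ->; rewrite ?normrN normr1 mul1r.
    rewrite /patch nd; case: ifPn => [/set_mem Ks|nKs].
      by have [s01 _] := off Ks; rewrite mem_set//= in_itv.
    case: ifPn => // /set_mem /=; rewrite in_itv/= => s01.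
    rewrite x1E0 ?normr0//; apply/eqP; rewrite eq_le Y0// andbT leNgt.
    by apply: contra nKs => Ys; apply/mem_set; split; rewrite //= in_itv.
  pose Z s := d * (X s - xc).
  have dZ s : 0 <= s < 1 -> is_derive s (1 : R) Z (d * x1 s).
    move=> s01; have [dX _ _ _] := dc s01.
    have := is_derive_mulR (is_derive_cstR d s)
      (is_derive_addR dX (is_derive_cstR (- xc) s)).
    by move=> /is_derive_congr; apply; rewrite mul0r add0r addr0.
  have Z2 s : Z s ^+ 2 = (X s - xc) ^+ 2 by rewrite exprMn expr2 dd mul1r.
  apply: (total_variation a0 e1 dZ).
  - move=> s s01; apply: cvgM; [exact: cvg_cst|exact: cx1].
  - by move=> s s01; rewrite Z2 -(circ s01) lerDl sqr_ge0.
  - move=> s s01; rewrite Z2 -(circ s01) ltrDl => y2.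
    have dN0 : d != 0 by case: d1 => ->; rewrite ?oppr_eq0 oner_eq0.
    rewrite mulf_neq0// x1N0// lt_neqAle Y0// andbT eq_sym.
    by apply: contraTneq y2 => ->; rewrite expr0n ltxx.
  - move=> s s01; rewrite Z2 -(circ s01) => /eqP.
    rewrite -subr_eq0 opprD addrA subrr sub0r oppr_eq0 sqrf_eq0 => /eqP y0.
    by rewrite x1E0// mulr0.
  - by rewrite /Z /X /= c0 subrr mulr0.
  - rewrite x10 mulrA dd mul1r lt_neqAle speed_ge0 eq_sym imm//.
      by rewrite lexx ltr01.
    by rewrite /Y/= c0.
  - have -> : e * a = d * (xe - xc) by rewrite /e divfK.
    apply: cvgM; first exact: cvg_cst.
    by apply: cvgB => //; exact: cvg_cst.
  - move=> s s01 Zs; apply: (cNxe s01).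
    have Xs : X s = xe.
      have : X s - xc = xe - xc by rewrite xeE -Zs /Z mulrA dd mul1r.
      by move=> /addIr.
    have Ys : Y s = 0.
      apply/eqP; rewrite -sqrf_eq0; apply/eqP.
      by have := circ s01; rewrite Xs end_circle; lra.
    by rewrite [c s]surjective_pairing -/(X s) -Xs -Ys.
exists (2 * pi * (2 - e)), 0; split.
- rewrite (revol_willmoreE mK (h := fun s => 4 / a * `|x1 s|)).
  + under eq_integral do rewrite EFinM.
    rewrite ge0_integralZl//=; last 2 first.
    * exact/measurable_EFinP.
    * by rewrite lee_fin divr_ge0// ltW.
    by rewrite var -!EFinM; congr EFin; field.
  + by apply: measurable_funM => //; exact: measurable_cst.
  + by move=> s /off[s01 y0]; split; [exact: imm|exact: curvature_circle].
- apply: (density_finite_area_arc dc (h := fun s => a * `|x1 s|)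
    (A := a * ((2 - e) * a))).
  + by apply: measurable_funM => //; exact: measurable_cst.
  + by move=> s /off[s01 y0]; rewrite area_circle.
  + under eq_integral do rewrite EFinM.
    rewrite ge0_integralZl//=; last 2 first.
    * exact/measurable_EFinP.
    * by rewrite lee_fin ltW.
    by rewrite var.
- have e2 : e * e = 1 by case: e1 => ->; lra.
  rewrite /axis_fraction xeE.
  have -> : (d * (e * a)) ^+ 2 = (d * d) * (e * e) * a ^+ 2 by ring.
  have -> : d * (a * (d * (e * a)) / (a ^+ 2 + d * d * (e * e) * a ^+ 2)) =
      (d * d) * (a * (e * a) / (a ^+ 2 + (d * d) * (e * e) * a ^+ 2)) by ring.
  rewrite dd e2 !mul1r; field; rewrite -mulr2n mulrn_eq0/= expf_neq0//.
Qed.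
End HalfCircle.
End Arcs.

(** * Caps with horizontal boundary direction *)

Section Caps.
Context {R : realType}.
Local Notation mu := (@lebesgue_measure R).
Variables (xc a b : R).
Hypotheses (a0 : 0 < a) (sb : sin b = 0) (cb : cos b = 1 \/ cos b = -1).

Let g (t : R) : R * R := (xc + a * cos t, a * sin t).

Lemma circ_param_hemisphere : circ_param xc a b = g.
Proof.
apply/funext => t; rewrite /circ_param /tan sb mul0r mulr0 addr0.
by have -> : `|cos b| = 1 by [case: cb => ->; rewrite ?normrN normr1]; rewrite divr1.
Qed.

Let dg1 t : is_derive t (1 : R) (fst \o g) (- (a * sin t)).
Proof.
have := is_derive_addR (is_derive_cstR xc t)
  (is_derive_mulR (is_derive_cstR a t) (is_derive_cos t)).
by move=> /is_derive_congr; apply; rewrite mul0r !add0r mulrN.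
Qed.

Let dg2 t : is_derive t (1 : R) (snd \o g) (a * cos t).
Proof.
have := is_derive_mulR (is_derive_cstR a t) (is_derive_sin t).
by move=> /is_derive_congr; apply; rewrite mul0r !add0r.
Qed.

Let g1E : derive1 (fst \o g) = fun t => - (a * sin t).
Proof. by apply/funext => t; exact: (is_derive_derive1 (dg1 t)). Qed.

Let g2E : derive1 (snd \o g) = fun t => a * cos t.
Proof. by apply/funext => t; exact: (is_derive_derive1 (dg2 t)). Qed.

Let g11E : derive1 (derive1 (fst \o g)) = fun t => - (a * cos t).
Proof.
apply/funext => t; rewrite g1E.
exact: (is_derive_derive1 (is_derive_oppR (dg2 t))).
Qed.

Let g22E : derive1 (derive1 (snd \o g)) = fun t => - (a * sin t).
Proof.
apply/funext => t; rewrite g2E.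
rewrite (is_derive_derive1 (is_derive_mulR (is_derive_cstR a t) (is_derive_cos t))).
by rewrite mul0r add0r mulrN.
Qed.

Let speed_g t : speed g t = a.
Proof.
rewrite /speed g1E g2E sqrrN !exprMn -mulrDr addrC cos2Dsin2 mulr1.
by rewrite sqrtr_sqr gtr0_norm.
Qed.

Let cap_curvature t : 0 < (g t).2 ->
  mean_curvature g t ^+ 2 * ((g t).2 * speed g t) = 4 * sin t.
Proof.
rewrite /g/= => s0; have aN0 := lt0r_neq0 a0.
have sN0 : sin t != 0 by move: s0; rewrite pmulr_rgt0// => /lt0r_neq0.
rewrite /mean_curvature speed_g g11E g22E g1E g2E /=.
have -> : - (a * cos t) * (a * cos t) - - (a * sin t) * - (a * sin t) =
   - a ^+ 2 by ring: (sin2cos2 t).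
by field; rewrite aN0 sN0.
Qed.

Let dom := circ_dom xc a b.

Let domE t : dom t <-> 0 < t < pi /\ cos b * cos t <= 0.
Proof.
have aN0 := lt0r_neq0 a0.
have c2 : cos b ^+ 2 = 1 by case: cb => ->; rewrite ?sqrrN expr1n.
rewrite /dom/circ_dom/= circ_param_hemisphere /gamma_circ /tan sb mul0r mulr0.
rewrite /g/= c2 divr1 !subr0 (addrC xc) addrK real_normK ?num_real//.
split=> [[tpi [_ _]]|[tpi ct]].
  by rewrite mulrCA pmulr_rle0.
split=> //; split.
- by rewrite mulr_gt0// sin_gt0_pi.
- by ring: (sin2cos2 t).
- by rewrite mulrCA pmulr_rle0.
Qed.

Let off_axis_dom : off_axis g dom = dom.
Proof.
apply/seteqP; split=> t [] //= => tpi ct; split=> //.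
by rewrite /g/= mulr_gt0// sin_gt0_pi.
Qed.

Let dcos4 t : is_derive t (1 : R) (fun t => - (4 * cos t)) (4 * sin t).
Proof.
have := is_derive_oppR (is_derive_mulR (is_derive_cstR 4 t) (is_derive_cos t)).
by move=> /is_derive_congr; apply; rewrite mul0r add0r mulrN opprK.
Qed.

Let csin4 t : {for t, continuous (fun t : R => 4 * sin t)}.
Proof. by apply: cvgM; [exact: cvg_cst|exact: continuous_sin]. Qed.

Let measurable_dom_integral : measurable dom /\
  (\int[mu]_(t in dom) (4 * sin t)%:E = 4%:E)%E.
Proof.
have p0 := pi_gt0 R.
case: cb => cbE.
  have -> : dom = `[pi / 2, pi[%classic.
    apply/seteqP; split=> t; rewrite /= in_itv/=.
      move=> /domE[tpi]; rewrite cbE mul1r => ct.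
      rewrite (andP tpi).2 andbT leNgt; apply/negP => tp.
      have : 0 < cos t by apply: cos_gt0_pihalf; lra.
      lra.
    move=> tp; apply/domE; rewrite cbE mul1r; split; first by lra.
    rewrite -(subrK pi t) cosDpi oppr_le0; apply: cos_ge0_pihalf; lra.
  split; first exact: measurable_itv.
  have -> : 4%:E = (- (4 * cos pi) - - (4 * cos (pi / 2)))%:E :> \bar R.
    by rewrite cospi cos_pihalf; congr EFin; lra.
  apply: (@FTC_right_open _ _ (fun t => - (4 * cos t))) => //.
  - lra.
  - move=> t tp; rewrite mulr_ge0// sin_ge0_pi//; lra.
  - have /cvg_at_left_filter := is_derive_continuous (dcos4 pi); exact.
have -> : dom = `]0, pi / 2]%classic.
  apply/seteqP; split=> t; rewrite /= in_itv/=.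
    move=> /domE[tpi]; rewrite cbE mulN1r oppr_le0 => ct.
    rewrite (andP tpi).1 /= leNgt; apply/negP => tp.
    have : cos t < 0.
      rewrite -(subrK pi t) cosDpi oppr_lt0; apply: cos_gt0_pihalf; lra.
    lra.
  move=> tp; apply/domE; rewrite cbE mulN1r oppr_le0; split; first by lra.
  by apply: cos_ge0_pihalf; lra.
split; first exact: measurable_itv.
have ms : measurable_fun setT (fun t : R => (4 * sin t)%:E).
  apply/measurable_EFinP; apply: continuous_measurable => // t _; exact: csin4.
rewrite integral_itv_obnd_cbnd; last exact: measurable_funTS.
have -> : 4%:E = (- (4 * cos (pi / 2)) - - (4 * cos 0))%:E :> \bar R.
  by rewrite cos0 cos_pihalf; congr EFin; lra.
apply: (@FTC_closed _ _ (fun t => - (4 * cos t))) => //; lra.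
Qed.

(** As tan b = 0, the center of the cap lies below its boundary point, so that the
    cap is a hemisphere of radius a. *)
Lemma cap_energy : cap_willmore xc a b = (2 * pi)%:E /\
  cap_density xc a b = 0%:E.
Proof.
have [mdom int4] := measurable_dom_integral.
have cg1 t : dom t -> {for t, continuous (fst \o g)}.
  by move=> _; exact: is_derive_continuous (dg1 t).
have cg2 t : dom t -> {for t, continuous (snd \o g)}.
  by move=> _; exact: is_derive_continuous (dg2 t).
have ms (k : R) : measurable_fun dom (fun t : R => k * sin t).
  apply: continuous_measurable => // t _.
  by apply: cvgM; [exact: cvg_cst|exact: continuous_sin].
rewrite /cap_willmore /cap_density circ_param_hemisphere; split.
  rewrite (revol_willmoreE (h := fun t => 4 * sin t)) ?off_axis_dom//.
    by rewrite int4 -EFinM; congr EFin; field.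
  move=> t dt; have [_ y0] : off_axis g dom t by rewrite off_axis_dom.
  by split; [rewrite speed_g gt_eqF|exact: cap_curvature].
apply: (density_finite_area mdom cg1 cg2 (h := fun t => a ^+ 2 * sin t)
  (A := a ^+ 2)).
- by rewrite off_axis_dom.
- by move=> t _; rewrite speed_g /g/=; ring.
- rewrite off_axis_dom (_ : (fun t => _) =
    (fun t => (a ^+ 2 / 4)%:E * (4 * sin t)%:E)%E); last first.
    by apply/funext => t; rewrite -EFinM; congr EFin; field.
  rewrite ge0_integralZl; first by rewrite int4 -EFinM lee_fin divfK.
  + exact: mdom.
  + by apply/measurable_EFinP; exact: ms.
  + move=> t; rewrite -off_axis_dom => -[_]; rewrite /g/= pmulr_rgt0// => s0.
    by rewrite lee_fin mulr_ge0// ltW.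
  + by rewrite lee_fin divr_ge0// sqr_ge0.
Qed.

End Caps.

(** * Hyperbolic functions and Moebius maps of the half plane *)

Section Hyperbolic.
Context {R : realType}.
Implicit Types u : R.

Definition ch u : R := (expR u + expR (- u)) / 2.
Definition sh u : R := (expR u - expR (- u)) / 2.

Lemma ch_gt0 u : 0 < ch u.
Proof. by rewrite divr_gt0// addr_gt0// expR_gt0. Qed.

Lemma chN u : ch (- u) = ch u.
Proof. by rewrite /ch opprK addrC. Qed.

Lemma sqr_ch u : ch u ^+ 2 = 1 + sh u ^+ 2.
Proof.
have e : expR u * expR (- u) = 1 by rewrite expRN divff// gt_eqF// expR_gt0.
by rewrite /ch /sh; field: e.
Qed.

End Hyperbolic.

Section HalfPlaneMoebius.
Context {R : realType}.
Local Open Scope complex_scope.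
Local Notation Re := complex.Re.
Local Notation Im := complex.Im.
Local Notation H := (@upper_half_plane R).
Implicit Types (z w a b c d e f : R[i]).

Lemma Im_affine e f (x y : R) :
  Im (e * (x +i* y) + f) = Re e * y + Im e * x + Im f.
Proof. by case: e f => [e1 e2] [f1 f2] /=. Qed.

Lemma Im_inv z : Im z^-1 = - Im z / (Re z ^+ 2 + Im z ^+ 2).
Proof. by case: z => [x y] /=; rewrite mulNr. Qed.

Lemma Im_opp_inv_gt0 z : 0 < Im z -> 0 < Im (- z^-1).
Proof.
move=> z0; rewrite raddfN/= Im_inv mulNr opprK divr_gt0//.
by rewrite ltr_wpDl ?sqr_ge0// exprn_gt0.
Qed.

(** An affine map onto the half plane preserves its boundary: the map cannot
    rotate, and surjectivity excludes a vertical shift. *)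
Lemma affine_half_plane e f : (fun z => e * z + f) @` H = H ->
  [/\ 0 < Re e, Im e = 0 & Im f = 0].
Proof.
move=> /seteqP[sub sup].
have pos (x y : R) : 0 < y -> 0 < Re e * y + Im e * x + Im f.
  by move=> y0; rewrite -Im_affine; apply: sub; exists (x +i* y).
have e2 : Im e = 0.
  apply/eqP; apply: contraT => e2.
  have := pos (- (Re e + Im f) / Im e) 1 ltr01.
  suff -> : Re e * 1 + Im e * (- (Re e + Im f) / Im e) + Im f = 0 by rewrite ltxx.
  by field.
have {}pos (y : R) : 0 < y -> 0 < Re e * y + Im f.
  by move=> /(pos 0); rewrite e2 mul0r addr0.
have f2 : Im f = 0.
  have [f2|f2|//] := ltgtP (Im f) 0; exfalso.
    have e1 := pos 1 ltr01.
    have e1' : 0 < Re e by lra.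
    have := pos (- Im f / (2 * Re e))
      ltac:(by rewrite divr_gt0 ?mulr_gt0 ?oppr_gt0).
    rewrite (_ : Re e * _ = - Im f / 2); first lra.
    by field; exact: lt0r_neq0.
  have e1 : 0 <= Re e.
    rewrite leNgt; apply/negP => e1.
    have := pos (- Im f / Re e)
      ltac:(by rewrite mulNr -mulrN -invrN divr_gt0 ?oppr_gt0).
    suff -> : Re e * (- Im f / Re e) + Im f = 0 by rewrite ltxx.
    by field; rewrite lt_eqF.
  have [] := sup (0 +i* (Im f / 2)); first by rewrite /upper_half_plane/= divr_gt0.
  move=> [x y] y0 /(congr1 (@Im R)); rewrite Im_affine e2 mul0r addr0 /=.
  have : 0 <= Re e * y by rewrite mulr_ge0// ltW.
  lra.
split=> //; have := pos 1 ltr01; rewrite f2; lra.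
Qed.

Lemma complex_real z : Im z = 0 -> z = (Re z)%:C.
Proof. by case: z => x y /= ->. Qed.

(** A fractional linear map of the upper half plane onto itself is real affine
    or real affine in the negative of the reciprocal of z - q, with q its pole.
    The pole lies on the axis: above it, it would have no image in the half
    plane; below it, the image of the half plane would be bounded. *)
Lemma moebius_half_plane a b c d : a * d - b * c != 0 ->
  (fun z => (a * z + b) / (c * z + d)) @` H = H ->
  (exists k r : R, 0 < k /\
     forall z, H z -> (a * z + b) / (c * z + d) = k%:C * z + r%:C) \/
  (exists k x0 q : R, 0 < k /\ forall z, H z ->
     (a * z + b) / (c * z + d) = x0%:C - k%:C * (z - q%:C)^-1).
Proof.
move=> det MH; have [c0|cN0] := eqVneq c 0.
  left; have dN0 : d != 0.
    by apply: contraNneq det => ->; rewrite c0 !mulr0 subrr.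
  have ME : (fun z => (a * z + b) / (c * z + d)) = fun z => a / d * z + b / d.
    by apply/funext => z; rewrite c0 mul0r add0r; field.
  rewrite ME in MH; have [e1 e2 f2] := affine_half_plane MH.
  exists (Re (a / d)), (Re (b / d)); split=> // z _.
  by rewrite -!complex_real//; have /(congr1 (fun g : R[i] -> R[i] => g z)) := ME.
right; set q := - (d / c); set x0 := a / c.
set E := (a * d - b * c) / c ^+ 2.
have EN0 : E != 0 by rewrite mulf_neq0// invr_eq0 expf_neq0.
have ME z : z != q -> (a * z + b) / (c * z + d) = x0 - E * (z - q)^-1.
  move=> zq; have zqN0 : c * z + d != 0.
    apply: contra zq => /eqP e; apply/eqP; rewrite /q.
    by apply: (mulfI cN0); rewrite mulrN mulrCA divff// mulr1; apply/eqP;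
      rewrite -subr_eq0 opprK e.
  have zq' : z - q = (c * z + d) / c by rewrite /q; field.
  by rewrite zq' /x0 /E; field; rewrite cN0 zqN0.
have q2 : Im q = 0.
  move: MH => /seteqP[sub sup].
  have [q2|q2|//] := ltgtP (Im q) 0; exfalso.
    (* A point iT + x0 so high that its preimage is close to the pole q, hence
       below the axis: z - q = iE / T. *)
    pose T := 1 + `|Im x0| + (1 + `|Re E|) / - Im q.
    have q2' : 0 < - Im q by rewrite oppr_gt0.
    have T1 : 0 <= (1 + `|Re E|) / - Im q by rewrite divr_ge0 ?addr_ge0// ltW.
    have n0 := normr_ge0 (Im x0).
    have T0 : 0 < T by rewrite /T; lra.
    have TE : Re E < - Im q * T.
      have -> : - Im q * T = - Im q * (1 + `|Im x0|) + (1 + `|Re E|).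
        by rewrite /T; field; rewrite lt_eqF.
      have := ler_norm (Re E).
      have : 0 < - Im q * (1 + `|Im x0|) by rewrite mulr_gt0//; lra.
      lra.
    have HT : H (x0 + 0 +i* T).
      rewrite /upper_half_plane/= raddfD/=.
      by have := ler_norm (- Im x0); rewrite normrN /T; lra.
    have [z Hz] := sup _ HT.
    have zq : z != q.
      by apply: contraTneq Hz => ->; rewrite /upper_half_plane/= -leNgt ltW.
    have zqN0 : z - q != 0 by rewrite subr_eq0.
    rewrite ME// => /addrI /(congr1 (fun w => w * (z - q))).
    rewrite mulNr mulfVK// => /(congr1 (@Re R)).
    have -> : Re ((0 +i* T) * (z - q)) = - (T * (Im z - Im q)).
      by case: (z) (q) => [? ?] [? ?] /=; ring.
    rewrite raddfN/= => ReE.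
    have : T * Im z < 0 by lra.
    by rewrite pmulr_rlt0// ltNge; move: Hz; rewrite /upper_half_plane/= => /ltW ->.
  have : H ((a * q + b) / (c * q + d)) by apply: sub; exists q.
  have -> : c * q + d = 0 by rewrite /q mulrN mulrCA divff// mulr1 addNr.
  by rewrite invr0 mulr0 /upper_half_plane/= ltxx.
have HN z : H z -> z != q.
  by apply: contraTneq => ->; rewrite /upper_half_plane/= q2 ltxx.
have EH : (fun z => E * z + x0) @` H = H.
  move: MH => /seteqP[sub sup]; apply/seteqP; split=> w.
    move=> [z Hz <-]; pose z' := q - z^-1.
    have Hz' : H z'.
      by rewrite /upper_half_plane/= raddfD/= q2 add0r; exact: Im_opp_inv_gt0.
    have -> : E * z + x0 = (a * z' + b) / (c * z' + d).
      rewrite ME ?HN// /z' addrAC subrr add0r invrN invrK.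
      by rewrite mulrN opprK addrC.
    by apply: sub; exists z'.
  move=> /sup[z Hz <-]; exists (- (z - q)^-1).
    rewrite /=; apply: Im_opp_inv_gt0.
    by rewrite raddfB/= q2 subr0.
  by rewrite ME ?HN// mulrN addrC.
have [e1 e2 f2] := affine_half_plane EH.
exists (Re E), (Re x0), (Re q); split=> // z Hz.
by rewrite -!complex_real// ME// HN.
Qed.

Lemma catenary_half_plane (t : R) : H (catenary t).
Proof. exact: ch_gt0. Qed.

Definition sqr_dist_catenary (q t : R) : R := (t - q) ^+ 2 + ch t ^+ 2.

Lemma moebius_catenary a b c d : a * d - b * c != 0 ->
  (fun z => (a * z + b) / (c * z + d)) @` H = H ->
  (exists k r : R, 0 < k /\ forall t,
     (a * catenary t + b) / (c * catenary t + d) =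
     (r + k * t) +i* (k * ch t)) \/
  (exists k x0 q : R, 0 < k /\ forall t,
     (a * catenary t + b) / (c * catenary t + d) =
     (x0 - k * (t - q) / sqr_dist_catenary q t) +i*
     (k * ch t / sqr_dist_catenary q t)).
Proof.
move=> det MH.
have [[k [r [k0 ME]]]|[k [x0 [q [k0 ME]]]]] := moebius_half_plane det MH.
  left; exists k, r; split=> // t; rewrite ME; last exact: catenary_half_plane.
  by apply/eqP; rewrite eq_complex /=; apply/andP; split; apply/eqP;
    rewrite -/(ch t); ring.
right; exists k, x0, q; split=> // t; rewrite ME; last exact: catenary_half_plane.
have -> : catenary t - q%:C = (t - q) +i* ch t.
  by apply/eqP; rewrite eq_complex /= subr0 !eqxx.
rewrite /sqr_dist_catenary; apply/eqP; rewrite eq_complex /=.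
by apply/andP; split; apply/eqP; ring.
Qed.

(** The reflection in the vertical axis fixes the catenary, so that the
    orientation reversing maps yield no further curves. *)
Lemma moebius_catenoid_normal_form (C : set R[i]) : moebius_catenoid C ->
  (exists k r : R, 0 < k /\ forall z, C z -> exists t,
     z = (r + k * t) +i* (k * ch t)) \/
  (exists k x0 q : R, 0 < k /\ forall z, C z -> exists t,
     z = (x0 - k * (t - q) / sqr_dist_catenary q t) +i*
         (k * ch t / sqr_dist_catenary q t)).
Proof.
move=> [M [a [b [c [d [det ME MH]]]]] ->].
suff [a' [b' [c' [d' [det' MH' ME']]]]] : exists a' b' c' d' : R[i],
    [/\ a' * d' - b' * c' != 0,
        (fun z => (a' * z + b') / (c' * z + d')) @` H = H &
        forall t, exists t', M (catenary t) =
          (a' * catenary t' + b') / (c' * catenary t' + d')].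
  have [[k [r [k0 N]]]|[k [x0 [q [k0 N]]]]] := moebius_catenary det' MH'.
    by left; exists k, r; split=> // z [t _ <-]; have [t' /= ->] := ME' t;
      exists t'.
  by right; exists k, x0, q; split=> // z [t _ <-]; have [t' /= ->] := ME' t;
    exists t'.
case: ME => ME.
  exists a, b, c, d; split=> //.
    by rewrite -[RHS]MH; congr (_ @` _); apply/funext => z; rewrite ME.
  by move=> t; exists t.
have refl z : H z -> H (- conjc z).
  by case: z => x y; rewrite /upper_half_plane/= opprK.
exists (- a), b, (- c), d; split.
- by rewrite mulNr mulrN opprK -oppr_eq0 opprD !opprK in det *.
- rewrite -[RHS]MH; apply/seteqP; split=> w [z Hz <-]; exists (- conjc z).
  + exact: refl.
  + have -> : M (- conjc z) = (a * - z + b) / (c * - z + d).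
      by rewrite ME rmorphN/= conjcK.
    by rewrite !mulrN !mulNr.
  + exact: refl.
  + by rewrite ME !mulrN !mulNr !opprK.
- move=> t; exists (- t); rewrite ME.
  have -> : conjc (catenary t) = - catenary (- t).
    rewrite /catenary -/(ch t) -/(ch (- t)) chN.
    by apply/eqP; rewrite eq_complex /= ?opprK !eqxx.
  by rewrite !mulrN !mulNr.
Qed.

End HalfPlaneMoebius.

(** * Limits along the catenary and reparametrisation *)

Section HyperbolicCalculus.
Context {R : realType}.
Implicit Types u m : R.

Lemma is_derive_expRN u : is_derive u (1 : R) (fun x => expR (- x)) (- expR (- u)).
Proof.
have := is_derive_compR (is_derive_oppR (is_derive_idR u)) (is_derive_expR (- u)).
by move=> /is_derive_congr; apply; rewrite mulrN1.
Qed.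

Lemma is_derive_ch u : is_derive u (1 : R) ch (sh u).
Proof.
have := is_derive_mulR (is_derive_addR (is_derive_expR u) (is_derive_expRN u))
  (is_derive_cstR 2^-1 u).
by move=> /is_derive_congr; apply; rewrite /sh mulr0 addr0.
Qed.

Lemma is_derive_sh u : is_derive u (1 : R) sh (ch u).
Proof.
have := is_derive_mulR (is_derive_addR (is_derive_expR u)
  (is_derive_oppR (is_derive_expRN u))) (is_derive_cstR 2^-1 u).
by move=> /is_derive_congr; apply; rewrite /ch mulr0 addr0 opprK.
Qed.

Lemma ch_ge1 u : 1 <= ch u.
Proof.
have := sqr_ch u; have := ch_gt0 u; have := sqr_ge0 (sh u).
by move=> h2 h0 e; rewrite leNgt; apply/negP => h1; nra.
Qed.

Lemma ch_ge_pow4 u : 0 <= u -> u ^+ 4 <= 48 * ch u.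
Proof.
move=> u0; have := expR_ge1Dxn 3 u0; rewrite (_ : (4`!)%:R = 24)// => h.
have h2 : u ^+ 4 <= 24 * expR u.
  by rewrite -ler_pdivrMl// mulrC; lra.
have := expR_ge0 (- u); rewrite /ch; lra.
Qed.

Lemma ch_le_expR u : ch u <= expR `|u|.
Proof.
have h1 : expR u <= expR `|u| by rewrite ler_expR ler_norm.
have h2 : expR (- u) <= expR `|u| by rewrite ler_expR -normrN ler_norm.
rewrite /ch; lra.
Qed.

Lemma chBsh u : ch u - sh u = expR (- u).
Proof. rewrite /ch /sh; lra. Qed.

(** The energy of the inverted catenoid has 4 pi times this primitive with respect
    to the parameter u of the catenary; m is the center of the inversion. *)
Definition catenoid_primitive m u : R :=
  ((u - m) + sh u * ch u) / sqr_dist_catenary m u.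

Lemma sqr_dist_gt0 m u : 0 < sqr_dist_catenary m u.
Proof. by rewrite ltr_wpDl ?sqr_ge0// exprn_gt0// ch_gt0. Qed.

(** All limits at infinity below have an error bounded by a multiple of 1 / u. *)
Lemma cvg_le_inv (f : R -> R) (l K : R) :
  (forall u, 1 <= u -> `|f u - l| <= K / u) -> f u @[u --> +oo] --> l.
Proof.
move=> fK; apply/cvgrPdist_le => e e0; near=> u.
have u1 : 1 <= u by near: u; apply: nbhs_pinfty_ge; exact: num_real.
have uK : K / e <= u by near: u; apply: nbhs_pinfty_ge; exact: num_real.
have u0 : 0 < u by lra.
rewrite distrC (le_trans (fK u u1))// ler_pdivrMr// mulrC.
by rewrite -ler_pdivrMr.
Unshelve. all: end_near. Qed.

Lemma catenoid_primitive_cvg m :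
  catenoid_primitive m u @[u --> +oo] --> (1 : R).
Proof.
pose M := 1 + `|m|; have n0 := normr_ge0 m.
apply: (@cvg_le_inv _ _ (48 * (M + M ^+ 2 + 1))) => u u1.
have D0 := sqr_dist_gt0 m u; have v0 := ch_gt0 u; have v1 := ch_ge1 u.
have u4 := @ch_ge_pow4 u ltac:(lra).
have -> : catenoid_primitive m u - 1 =
   ((u - m) - (u - m) ^+ 2 - ch u * expR (- u)) / sqr_dist_catenary m u.
  rewrite -chBsh /catenoid_primitive /sqr_dist_catenary; field.
  by rewrite gt_eqF//; exact: D0.
rewrite normrM (ger0_norm (x := _^-1)) ?invr_ge0 ?(ltW D0)//.
have um : `|u - m| <= M * u.
  have := ler_normB u m; rewrite (@ger0_norm _ u) /M; last by lra.
  have : `|m| * 1 <= `|m| * u by rewrite ler_wpM2l.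
  lra.
have um2 : (u - m) ^+ 2 <= M ^+ 2 * u ^+ 2.
  by rewrite -exprMn -[leLHS]real_normK ?num_real// ler_pXn2r// nnegrE mulr_ge0//
    /M; lra.
have ev : ch u * expR (- u) <= ch u.
  by apply: ler_piMr; [exact: ltW|rewrite -expR0 ler_expR; lra].
have num : `|(u - m) - (u - m) ^+ 2 - ch u * expR (- u)| <=
    M * u + M ^+ 2 * u ^+ 2 + ch u.
  rewrite !(le_trans (ler_normB _ _))// lerD//.
    rewrite (le_trans (ler_normB _ _))// lerD//.
    by rewrite ger0_norm ?sqr_ge0.
  by rewrite ger0_norm// mulr_ge0 ?expR_ge0// ltW.
apply: (@le_trans _ _ ((M * u + M ^+ 2 * u ^+ 2 + ch u) / ch u ^+ 2)).
  apply: ler_pM => //; first by rewrite invr_ge0 ltW.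
  by rewrite lef_pV2 ?posrE// ?exprn_gt0// lerDr sqr_ge0.
rewrite ler_pdivrMr ?exprn_gt0// (mulrAC _ u^-1) ler_pdivlMr; last by lra.
have u_le k : (1 <= k <= 4)%N -> u ^+ k <= 48 * ch u.
  by move=> /andP[_ k4]; apply: le_trans u4; apply: ler_weXn2l.
have u1v : u ^+ 1 <= 48 * ch u by exact: u_le.
have u2v : u ^+ 2 <= 48 * ch u by exact: u_le.
have u3v : u ^+ 3 <= 48 * ch u by exact: u_le.
have vv : ch u <= ch u ^+ 2 by rewrite expr2; apply: ler_peMl => //; exact: ltW.
have M0 : 0 <= M by rewrite /M; lra.
have -> : (M * u + M ^+ 2 * u ^+ 2 + ch u) * u =
    M * u ^+ 2 + M ^+ 2 * u ^+ 3 + ch u * u ^+ 1 by ring.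
have h1 := ler_wpM2l M0 u2v; have h2 := ler_wpM2l (sqr_ge0 M) u3v.
have h3 := ler_wpM2l (ltW v0) u1v.
have h4 := ler_wpM2l M0 vv; have h5 := ler_wpM2l (sqr_ge0 M) vv.
lra.
Qed.

Lemma tanh_cvg : sh u / ch u @[u --> +oo] --> (1 : R).
Proof.
apply: (@cvg_le_inv _ _ 48) => u u1.
have v0 := ch_gt0 u; have u4 := @ch_ge_pow4 u ltac:(lra).
have -> : sh u / ch u - 1 = - (expR (- u) / ch u).
  by rewrite -chBsh; field; rewrite gt_eqF.
rewrite normrN ger0_norm; last by rewrite divr_ge0 ?expR_ge0// ltW.
have ev : expR (- u) <= 1 by rewrite -expR0 ler_expR; lra.
rewrite ler_pdivrMr// (mulrAC _ u^-1) ler_pdivlMr; last by lra.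
have : u ^+ 1 <= u ^+ 4 by apply: ler_weXn2l.
have : expR (- u) * u <= u by apply: ler_piMl => //; lra.
rewrite expr1; lra.
Qed.

End HyperbolicCalculus.

Section Reparametrisation.
Context {R : realType}.
Implicit Types s u : R.

(** This orients the parameter of the catenary along the arc. *)
Lemma constant_sign (f : R -> R) :
  (forall s, 0 <= s < 1 -> {for s, continuous f}) ->
  (forall s, 0 <= s < 1 -> f s != 0) ->
  exists sg : R, (sg = 1 \/ sg = -1) /\ forall s, 0 <= s < 1 -> 0 < sg * f s.
Proof.
move=> cf f0.
have pos (g : R -> R) : (forall s, 0 <= s < 1 -> {for s, continuous g}) ->
    (forall s, 0 <= s < 1 -> g s != 0) -> 0 < g 0 ->
    forall s, 0 <= s < 1 -> 0 < g s.
  move=> cg g0 g00 s s01; rewrite ltNge; apply/negP => gs.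
  have sn0 : 0 < s.
    rewrite lt_neqAle (andP s01).1 andbT; apply/eqP => s0.
    by move: gs; rewrite -s0 leNgt g00.
  have [|t [t0s gt0 _]] := first_zero sn0 _ g00 gs.
    by move=> x x0s; apply: cg; lra.
  by have /eqP := g0 t ltac:(lra).
have [f00|f00] := ltP 0 (f 0).
  exists 1; split; first by left.
  by move=> s s01; rewrite mul1r; exact: pos.
exists (-1); split; first by right.
move=> s s01; rewrite mulN1r; apply: (pos (fun s => - f s)) => //.
- by move=> u u01; apply: cvgN; exact: cf.
- by move=> u u01; rewrite oppr_eq0 f0.
- by rewrite oppr_gt0 lt_neqAle f00 f0// lexx ltr01.
Qed.

(** Here (P, Q) is a curve in the half plane parametrised by hyperbolic arc
    length, as are the catenary and its images under isometries: its Euclidean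
    speed is its height.  The arc c runs along it as prescribed by U. *)
Section UnitSpeed.
Variables (P Q P1 Q1 P2 Q2 : R -> R).
Hypothesis dP : forall u, is_derive u (1 : R) P (P1 u).
Hypothesis dQ : forall u, is_derive u (1 : R) Q (Q1 u).
Hypothesis dP1 : forall u, is_derive u (1 : R) P1 (P2 u).
Hypothesis dQ1 : forall u, is_derive u (1 : R) Q1 (Q2 u).
Hypothesis Q0 : forall u, 0 < Q u.
Hypothesis PQ : forall u, P1 u ^+ 2 + Q1 u ^+ 2 = Q u ^+ 2.
Variables (c : R -> R * R) (U U1 : R -> R).
Hypothesis dc : twice_derivable c.
Hypothesis dU : forall s, 0 <= s < 1 -> is_derive s (1 : R) U (U1 s).
Hypothesis dU1 : forall s, 0 <= s < 1 -> derivable U1 s 1.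
Hypothesis cE : forall s, 0 <= s < 1 -> c s = (P (U s), Q (U s)).

Lemma reparam_derive1_fst s : 0 <= s < 1 ->
  derive1 (fst \o c) s = P1 (U s) * U1 s.
Proof.
move=> s01; have [dX _ _ _] := dc s01.
apply: (is_derive_arc_unique s01 _ dX (is_derive_compR (dU s01) (dP _))).
by move=> u u01; rewrite /= cE.
Qed.

Lemma reparam_derive1_snd s : 0 <= s < 1 ->
  derive1 (snd \o c) s = Q1 (U s) * U1 s.
Proof.
move=> s01; have [_ dY _ _] := dc s01.
apply: (is_derive_arc_unique s01 _ dY (is_derive_compR (dU s01) (dQ _))).
by move=> u u01; rewrite /= cE.
Qed.

Lemma reparam_derive2_fst s : 0 <= s < 1 ->
  derive1 (derive1 (fst \o c)) s =
  P2 (U s) * U1 s * U1 s + P1 (U s) * derive1 U1 s.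
Proof.
move=> s01; have [_ _ dX _] := dc s01.
apply: (is_derive_arc_unique s01 _ dX (is_derive_mulR
  (is_derive_compR (dU s01) (dP1 _)) (derivable_is_derive (dU1 s01)))).
by move=> u u01; rewrite reparam_derive1_fst.
Qed.

Lemma reparam_derive2_snd s : 0 <= s < 1 ->
  derive1 (derive1 (snd \o c)) s =
  Q2 (U s) * U1 s * U1 s + Q1 (U s) * derive1 U1 s.
Proof.
move=> s01; have [_ _ _ dY] := dc s01.
apply: (is_derive_arc_unique s01 _ dY (is_derive_mulR
  (is_derive_compR (dU s01) (dQ1 _)) (derivable_is_derive (dU1 s01)))).
by move=> u u01; rewrite reparam_derive1_snd.
Qed.

Lemma reparam_speed s : 0 <= s < 1 -> speed c s = Q (U s) * `|U1 s|.
Proof.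
move=> s01; rewrite /speed reparam_derive1_fst// reparam_derive1_snd//.
by rewrite !exprMn -mulrDl PQ -exprMn sqrtr_sqr normrM (gtr0_norm (Q0 _)).
Qed.

Lemma reparam_curvature s : 0 <= s < 1 -> 0 < U1 s ->
  mean_curvature c s = (P2 (U s) * Q1 (U s) - Q2 (U s) * P1 (U s)) /
    Q (U s) ^+ 3 + P1 (U s) / Q (U s) ^+ 2.
Proof.
move=> s01 u1; rewrite /mean_curvature reparam_speed// (gtr0_norm u1).
rewrite reparam_derive1_fst// reparam_derive1_snd// reparam_derive2_fst//.
rewrite reparam_derive2_snd// cE//=.
by field; rewrite (lt0r_neq0 u1) (lt0r_neq0 (Q0 _)).
Qed.

End UnitSpeed.
End Reparametrisation.

(** * Inverted catenoids *)

Section CatenoidArcs.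
Context {R : realType}.
Local Notation mu := (@lebesgue_measure R).
Implicit Types s u : R.

(** The parameter of the catenary increases along the arc, and the catenary is
    left at its end only: if the points of the catenary move away to infinity,
    the parameter does so as well. *)
Section Escape.
Variables (U U1 : R -> R) (m : R).
Hypothesis dU : forall s, 0 <= s < 1 -> is_derive s (1 : R) U (U1 s).
Hypothesis U1_gt0 : forall s, 0 <= s < 1 -> 0 < U1 s.
Hypothesis far : forall A : R, exists2 s, 0 <= s < 1 &
  A < sqr_dist_catenary m (U s).

Lemma escape_lt s t : 0 <= s -> s < t -> t < 1 -> U s < U t.
Proof.
move=> s0 st t1; apply: (@derive_gt0_lt _ _ U1) => //.
  by move=> x xst; apply: dU; lra.
by move=> x xst; apply: U1_gt0; lra.
Qed.

Lemma escape_le s t : 0 <= s -> s <= t -> t < 1 -> U s <= U t.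
Proof.
move=> s0; rewrite le_eqVlt => /predU1P[<-//|st] t1.
exact/ltW/escape_lt.
Qed.

Lemma sqr_dist_bound u B : `|u| <= B ->
  sqr_dist_catenary m u <= (B + `|m|) ^+ 2 + expR B ^+ 2.
Proof.
move=> uB; have B0 : 0 <= B := le_trans (normr_ge0 _) uB.
apply: lerD.
  rewrite -(real_normK (num_real (u - m))).
  apply: lerXn2r; rewrite ?nnegrE ?addr_ge0//.
  by apply: le_trans (ler_normB _ _) _; rewrite lerD2r.
apply: lerXn2r; rewrite ?nnegrE ?expR_ge0 ?(ltW (ch_gt0 _))//.
by apply: le_trans (ch_le_expR u) _; rewrite ler_expR.
Qed.

Lemma escape_unbounded (A : R) : exists2 s, 0 <= s < 1 & A < U s.
Proof.
apply: contrapT => h.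
have UA s : 0 <= s < 1 -> U s <= A.
  by move=> s01; rewrite leNgt; apply/negP => AU; apply: h; exists s.
pose B := `|A| + `|U 0|.
have [s s01] := far ((B + `|m|) ^+ 2 + expR B ^+ 2).
rewrite ltNge sqr_dist_bound// /B ler_norml.
have := UA s s01; have := @escape_le 0 s (lexx 0) ltac:(lra) ltac:(lra).
have := ler_norm A; have := ler_norm (- U 0); rewrite normrN.
have := normr_ge0 A; have := normr_ge0 (U 0).
by move=> *; apply/andP; split; lra.
Qed.

Lemma escape_cvg : U s @[s --> 1^'-] --> +oo.
Proof.
apply/cvgryPgt => A; have [s s01 As] := escape_unbounded A.
near=> t.
have st : s < t by near: t; apply: nbhs_left_gt; lra.
have t1 : t < 1 by near: t; apply: nbhs_left_lt; lra.
by rewrite (lt_trans As)// escape_lt//; lra.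
Unshelve. all: end_near. Qed.

End Escape.

Lemma is_derive_sqr_dist (m u : R) : is_derive u (1 : R) (sqr_dist_catenary m)
  (2 * (u - m) + 2 * ch u * sh u).
Proof.
have := is_derive_addR
  (is_derive_sqrR (is_derive_addR (is_derive_idR u) (is_derive_cstR (- m) u)))
  (is_derive_sqrR (is_derive_ch u)).
by move=> /is_derive_congr; apply; rewrite addr0 mulr1.
Qed.

(** The curve (P, Q) is the image of the catenary under the inversion at the
    point m of the axis, followed by a similarity; D is the squared distance
    from m before the inversion.  The sign sg is a reflection, which allows the
    arc to run towards the end u = +oo of the catenary. *)
Section InvertedCatenoid.
Variables (x0 k m sg : R).
Hypotheses (k0 : 0 < k) (sg1 : sg * sg = 1).
Let D := sqr_dist_catenary m.
Let D1 u := 2 * (u - m) + 2 * ch u * sh u.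
Let N u := D u - (u - m) * D1 u.
Let L u := sh u * D u - ch u * D1 u.
Let P u := x0 - sg * k * ((u - m) / D u).
Let Q u := k * (ch u / D u).
Let P1 u := - (sg * k * (N u / D u ^+ 2)).
Let Q1 u := k * (L u / D u ^+ 2).
Let P2 u := - (sg * k * ((- (u - m) * (4 * ch u ^+ 2) * D u - 2 * N u * D1 u)
  / D u ^+ 3)).
Let Q2 u := k * ((ch u * (D u - 4 * ch u ^+ 2) * D u - 2 * L u * D1 u)
  / D u ^+ 3).

Let D0 u : 0 < D u. Proof. exact: sqr_dist_gt0. Qed.
Let DN0 u : D u != 0. Proof. exact: lt0r_neq0. Qed.
Let chN0 u : ch u != 0. Proof. by rewrite gt_eqF// ch_gt0. Qed.

Let dn u : is_derive u (1 : R) (fun u => u - m) 1.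
Proof.
have := is_derive_addR (is_derive_idR u) (is_derive_cstR (- m) u).
by move=> /is_derive_congr; apply; rewrite addr0.
Qed.

Let dD u : is_derive u (1 : R) D (D1 u).
Proof. exact: is_derive_sqr_dist. Qed.

Let dD1 u : is_derive u (1 : R) D1 (4 * ch u ^+ 2).
Proof.
have := is_derive_addR (is_derive_mulR (is_derive_cstR 2 u) (dn u))
  (is_derive_mulR (is_derive_mulR (is_derive_cstR 2 u) (is_derive_ch u))
    (is_derive_sh u)).
by move=> /is_derive_congr; apply; ring: (sqr_ch u).
Qed.

Let dP u : is_derive u (1 : R) P (P1 u).
Proof.
have := is_derive_addR (is_derive_cstR x0 u) (is_derive_oppR (is_derive_mulR
  (is_derive_cstR (sg * k) u)
  (is_derive_mulR (dn u) (is_derive_invR (dD u) (DN0 u))))).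
by move=> /is_derive_congr; apply; rewrite /P1 /N; field.
Qed.

Let dQ u : is_derive u (1 : R) Q (Q1 u).
Proof.
have := is_derive_mulR (is_derive_cstR k u)
  (is_derive_mulR (is_derive_ch u) (is_derive_invR (dD u) (DN0 u))).
by move=> /is_derive_congr; apply; rewrite /Q1 /L; field.
Qed.

Let dN u : is_derive u (1 : R) N (- (u - m) * (4 * ch u ^+ 2)).
Proof.
have := is_derive_addR (dD u) (is_derive_oppR (is_derive_mulR (dn u) (dD1 u))).
by move=> /is_derive_congr; apply; ring.
Qed.

Let dL u : is_derive u (1 : R) L (ch u * (D u - 4 * ch u ^+ 2)).
Proof.
have := is_derive_addR (is_derive_mulR (is_derive_sh u) (dD u))
  (is_derive_oppR (is_derive_mulR (is_derive_ch u) (dD1 u))).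
by move=> /is_derive_congr; apply; ring.
Qed.

Let D2N0 u : D u ^+ 2 != 0. Proof. exact: expf_neq0. Qed.

Let dP1 u : is_derive u (1 : R) P1 (P2 u).
Proof.
have := is_derive_oppR (is_derive_mulR (is_derive_cstR (sg * k) u)
  (is_derive_mulR (dN u)
    (is_derive_invR (is_derive_sqrR (dD u)) (D2N0 u)))).
by move=> /is_derive_congr; apply; rewrite /P2; field.
Qed.

Let dQ1 u : is_derive u (1 : R) Q1 (Q2 u).
Proof.
have := is_derive_mulR (is_derive_cstR k u) (is_derive_mulR (dL u)
    (is_derive_invR (is_derive_sqrR (dD u)) (D2N0 u))).
by move=> /is_derive_congr; apply; rewrite /Q2; field.
Qed.

Let Q0 u : 0 < Q u.
Proof. by rewrite mulr_gt0// divr_gt0// ch_gt0. Qed.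

Let PQ u : P1 u ^+ 2 + Q1 u ^+ 2 = Q u ^+ 2.
Proof.
have e : N u ^+ 2 + L u ^+ 2 = ch u ^+ 2 * D u ^+ 2.
  have -> : N u ^+ 2 + L u ^+ 2 = (1 + sh u ^+ 2) * D u ^+ 2 -
      2 * ((u - m) + sh u * ch u) * D u * D1 u +
      ((u - m) ^+ 2 + ch u ^+ 2) * D1 u ^+ 2 by rewrite /N /L; ring.
  by rewrite -sqr_ch -/(sqr_dist_catenary m u) -/(D u) /D1; ring.
have -> : P1 u ^+ 2 + Q1 u ^+ 2 =
    k ^+ 2 * ((sg * sg) * N u ^+ 2 + L u ^+ 2) / D u ^+ 4.
  by rewrite /P1 /Q1; field.
by rewrite sg1 mul1r e /Q; field.
Qed.

(* The inversion of a minimal surface has mean curvature proportional to the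
   distance from the center of inversion to the tangent planes
   of the minimal surface. *)
Let curvature_PQ u : (P2 u * Q1 u - Q2 u * P1 u) / Q u ^+ 3 + P1 u / Q u ^+ 2
  = - (4 * sg * (ch u - (u - m) * sh u) / (k * ch u)).
Proof.
have -> : ch u - (u - m) * sh u = (ch u * N u - (u - m) * L u) / D u ^+ 1.
  by rewrite /N /L; field.
rewrite /P2 /Q2 /P1 /Q1 /Q expr1; field.
by rewrite chN0 DN0 lt0r_neq0.
Qed.

Let T := catenoid_primitive m.

Let dT u : is_derive u (1 : R) T (2 * ((ch u - (u - m) * sh u) / D u) ^+ 2).
Proof.
have := is_derive_mulR (is_derive_addR (dn u)
    (is_derive_mulR (is_derive_sh u) (is_derive_ch u)))
  (is_derive_invR (dD u) (DN0 u)).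
move=> /is_derive_congr; apply.
have e1 : ch u ^+ 2 - 1 = sh u ^+ 2 by rewrite sqr_ch addrC addKr.
have e2 : ch u ^+ 2 - sh u ^+ 2 = 1 by rewrite sqr_ch addrK.
transitivity ((((ch u ^+ 2 - sh u ^+ 2) + ch u ^+ 2 + sh u ^+ 2) * D u -
    2 * (u - m + sh u * ch u) ^+ 2) / D u ^+ 2).
  by rewrite e2 /D1; field.
transitivity (2 * (ch u - (u - m) * sh u) ^+ 2 / D u ^+ 2); last by field.
congr (_ / _); transitivity (2 * ((u - m) ^+ 2 * (ch u ^+ 2 - 1) +
    ch u ^+ 2 * (ch u ^+ 2 - sh u ^+ 2) - 2 * (u - m) * sh u * ch u)).
  by rewrite /D /sqr_dist_catenary; ring.
by rewrite e1 e2; ring.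
Qed.

Variables (c : R -> R * R) (U U1 : R -> R) (xc a d : R).
Hypothesis dc : twice_derivable c.
Hypothesis dU : forall s, 0 <= s < 1 -> is_derive s (1 : R) U (U1 s).
Hypothesis dU1 : forall s, 0 <= s < 1 -> derivable U1 s 1.
Hypothesis U1_gt0 : forall s, 0 <= s < 1 -> 0 < U1 s.
Hypothesis cE : forall s, 0 <= s < 1 ->
  c s = (x0 - sg * k * ((U s - m) / sqr_dist_catenary m (U s)),
         k * (ch (U s) / sqr_dist_catenary m (U s))).
Hypothesis far : forall A : R, exists2 s, 0 <= s < 1 &
  A < sqr_dist_catenary m (U s).
Hypotheses (d1 : d * d = 1) (c0 : c 0 = (xc, a)).
Hypotheses (x10 : derive1 (fst \o c) 0 = d * speed c 0).
Hypotheses (y10 : derive1 (snd \o c) 0 = 0).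

Let cPQ s : 0 <= s < 1 -> c s = (P (U s), Q (U s)).
Proof. exact: cE. Qed.

Let z01 : 0 <= (0 : R) < 1. Proof. by rewrite lexx ltr01. Qed.

(** The start is horizontal, so that Q1 vanishes and P1 = d Q there.  These are
    two equations for n = u - m, v = cosh u and h = sinh u. *)
Let start : T (U 0) = d * axis_fraction a xc (Some x0).
Proof.
have u1 := U1_gt0 z01; have u1N0 := lt0r_neq0 u1; have kN0 := lt0r_neq0 k0.
have := reparam_derive1_fst dP dc dU cPQ z01.
rewrite x10 (reparam_speed dP dQ Q0 PQ dc dU cPQ z01) (gtr0_norm u1) mulrA.
move=> /(mulIf u1N0); have := reparam_derive1_snd dQ dc dU cPQ z01.
rewrite y10 => /esym/eqP; rewrite mulf_eq0 (negbTE u1N0) orbF /P1 /Q1 /Q.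
have [eX eY] : x0 - sg * k * ((U 0 - m) / D (U 0)) = xc /\
    k * (ch (U 0) / D (U 0)) = a by move: (cE z01); rewrite c0 => -[-> ->].
have D0' := D0 (U 0); have DN := DN0 (U 0); have vN := chN0 (U 0).
rewrite /T /catenoid_primitive /axis_fraction -/(D (U 0)).
have -> : x0 - xc = sg * k * ((U 0 - m) / D (U 0)) by rewrite -eX; ring.
rewrite -eY.
have DE : D (U 0) = (U 0 - m) ^+ 2 + ch (U 0) ^+ 2 by [].
have LE : L (U 0) = sh (U 0) * D (U 0) -
  2 * ch (U 0) * ((U 0 - m) + sh (U 0) * ch (U 0)) by rewrite /L /D1; ring.
have NE : N (U 0) = D (U 0) -
  2 * (U 0 - m) * ((U 0 - m) + sh (U 0) * ch (U 0)) by rewrite /N /D1; ring.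
have := sqr_ch (U 0).
move: LE NE DE D0' DN vN.
move: (U 0 - m) (ch (U 0)) (sh (U 0)) (D (U 0)) (L _) (N _).
move=> n v h E l w lE wE EE E0 EN vN v2.
move=> /eqP l0 w0.
have {}l0 : l = 0.
  move/eqP: l0; rewrite !mulf_eq0 (negbTE kN0) /= invr_eq0 expf_eq0/=.
  by rewrite (negbTE EN) orbF => /eqP.
have {w0} w0 : w * sg = - d * v * E.
  move: w0 => /(congr1 (fun x => x * E ^+ 2 / k)) w0.
  have : - (sg * w) = d * v * E.
    transitivity (- (sg * k * (w / E ^+ 2)) * E ^+ 2 / k).
      by field; rewrite EN kN0.
    by rewrite -w0; field; rewrite EN kN0.
  by move=> e; transitivity (- (d * v * E)); [rewrite -e|]; ring.
pose tau := - (d * sg).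
have tau2 : tau * tau = 1.
  by rewrite /tau mulrNN mulrACA d1 sg1 mulr1.
have wE' : w = tau * v * E.
  transitivity ((sg * sg) * w); first by rewrite sg1 mul1r.
  by rewrite -mulrA (mulrC sg w) w0 /tau; ring.
have hE : h * E = 2 * v * (n + h * v) by move: lE; rewrite l0 => /esym/eqP;
  rewrite subr_eq0 => /eqP.
have vh : v - n * h = tau * v ^+ 2.
  apply: (mulIf EN).
  transitivity (v * w); last by rewrite wE'; ring.
  by rewrite wE; transitivity (v * E - n * (h * E)); [ring|rewrite hE; ring].
have key : n + h * v = - (tau * n * v).
  have [h0|h0] := eqVneq h 0.
    have : v * (n + h * v) = 0.
      apply: (@mulfI _ 2) => //; rewrite mulr0 mulrA -hE h0 mul0r //.
    move/eqP; rewrite mulf_eq0 (negbTE vN) h0 mul0r addr0 => /eqP ->.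
    by rewrite mulr0 mul0r oppr0.
  apply: (mulfI h0); apply/eqP; rewrite -subr_eq0; apply/eqP.
  transitivity (n * h + h ^+ 2 * v + tau * v * (n * h)); first by ring.
  have -> : n * h = v - tau * v ^+ 2 by rewrite -vh; ring.
  have -> : h ^+ 2 = v ^+ 2 - 1 by rewrite v2 addrC addKr.
  transitivity (v ^+ 3 * (1 - tau * tau)); first by ring.
  by rewrite tau2 subrr mulr0.
have den : (k * (v / E)) ^+ 2 + (sg * k * (n / E)) ^+ 2 = k ^+ 2 / E.
  transitivity (k ^+ 2 * ((sg * sg) * n ^+ 2 + v ^+ 2) / E ^+ 2); first by field.
  by rewrite sg1 mul1r -EE; field.
by rewrite den key /tau; field; rewrite EN kN0.
Qed.

Let cU s : 0 <= s < 1 -> {for s, continuous U}.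
Proof. by move=> /dU; exact: is_derive_continuous. Qed.

Let cU1 s : 0 <= s < 1 -> {for s, continuous U1}.
Proof. by move=> /dU1 /derivable_is_derive; exact: is_derive_continuous. Qed.

Let continuous_compU1 (f : R -> R) s (b : R) : 0 <= s < 1 ->
  is_derive (U s) (1 : R) f b -> {for s, continuous (fun s => f (U s) * U1 s)}.
Proof.
move=> s01 df; apply: cvgM; last exact: cU1.
by apply: (@continuous_comp _ _ _ U f); [exact: cU|exact: is_derive_continuous df].
Qed.

Let off_axis01 : off_axis c `[0, 1[ = `[0, 1[%classic.
Proof.
apply/seteqP; split=> s; first by case.
by rewrite /= in_itv/= => s01; split; rewrite /= ?in_itv//= cPQ//=.
Qed.

Let speedE s : 0 <= s < 1 -> speed c s = Q (U s) * U1 s.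
Proof.
by move=> s01; rewrite (reparam_speed dP dQ Q0 PQ dc dU cPQ)// gtr0_norm// U1_gt0.
Qed.

Let areaE s : 0 <= s < 1 -> (c s).2 * speed c s = Q (U s) ^+ 2 * U1 s.
Proof. by move=> s01; rewrite speedE// cPQ//=; ring. Qed.

Let J u := 8 * (2 * ((ch u - (u - m) * sh u) / D u) ^+ 2).

Let curvatureE s : 0 <= s < 1 ->
  mean_curvature c s ^+ 2 * ((c s).2 * speed c s) = J (U s) * U1 s.
Proof.
move=> s01; rewrite areaE//.
rewrite (reparam_curvature dP dQ dP1 dQ1 Q0 PQ dc dU dU1 cPQ)// ?U1_gt0//.
rewrite curvature_PQ.
transitivity ((sg * sg) * (J (U s) * U1 s)); last by rewrite sg1 mul1r.
by rewrite /Q /J; field; rewrite DN0 chN0 lt0r_neq0.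
Qed.

Let dJ u : exists b : R, is_derive u (1 : R) J b.
Proof.
eexists; apply: (is_derive_mulR (is_derive_cstR 8 u) (is_derive_mulR
  (is_derive_cstR 2 u) (is_derive_sqrR (is_derive_mulR
    (is_derive_addR (is_derive_ch u) (is_derive_oppR
      (is_derive_mulR (dn u) (is_derive_sh u))))
    (is_derive_invR (dD u) (DN0 u)))))).
Qed.

Let integral_J : (\int[mu]_(s in `[0%R, 1%R[) (J (U s) * U1 s)%:E =
  (8 * (1 - T (U 0)))%:E)%E.
Proof.
have -> : 8 * (1 - T (U 0)) = 8 * 1 - 8 * T (U 0) by ring.
apply: (@FTC_right_open _ (fun s => J (U s) * U1 s) (fun s => 8 * T (U s))
  0 1 (8 * 1)); first exact: ltr01.
- move=> s s01; apply: mulr_ge0; last exact/ltW/U1_gt0.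
  by rewrite mulr_ge0// mulr_ge0// sqr_ge0.
- by move=> s s01; have [b db] := dJ (U s); exact: continuous_compU1 db.
- move=> s s01; have := is_derive_mulR (is_derive_cstR 8 s)
    (is_derive_compR (dU s01) (dT (U s))).
  by move=> /is_derive_congr; apply; rewrite mul0r add0r /J mulrA.
- apply: cvgM; first exact: cvg_cst.
  apply: (cvg_comp _ _ (escape_cvg dU U1_gt0 far)).
  exact: catenoid_primitive_cvg.
Qed.

(* Since D >= cosh^2, the area density is at most k^2 times the derivative
   of tanh. *)
Let integral_area : (\int[mu]_(s in `[0%R, 1%R[) (Q (U s) ^+ 2 * U1 s)%:E <=
  (k ^+ 2 * (1 - sh (U 0) / ch (U 0)))%:E)%E.
Proof.
have dtanh u : is_derive u (1 : R) (fun u => k ^+ 2 * (sh u / ch u))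
    (k ^+ 2 / ch u ^+ 2).
  have := is_derive_mulR (is_derive_cstR (k ^+ 2) u)
    (is_derive_mulR (is_derive_sh u) (is_derive_invR (is_derive_ch u) (chN0 u))).
  move=> /is_derive_congr; apply.
  transitivity (k ^+ 2 * (ch u ^+ 2 - sh u ^+ 2) / ch u ^+ 2).
    by field; exact: chN0.
  by rewrite sqr_ch addrK mulr1.
have v2 u : ch u ^+ 2 != 0 by rewrite expf_neq0.
have dv u : exists b : R, is_derive u (1 : R) (fun u => k ^+ 2 / ch u ^+ 2) b.
  eexists; apply: (is_derive_mulR (is_derive_cstR (k ^+ 2) u)
    (is_derive_invR (is_derive_sqrR (is_derive_ch u)) (v2 u))).
have cv s : 0 <= s < 1 ->
    {for s, continuous (fun s => k ^+ 2 / ch (U s) ^+ 2 * U1 s)}.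
  by move=> s01; have [b db] := dv (U s);
    exact: (continuous_compU1 (f := fun u => k ^+ 2 / ch u ^+ 2) s01 db).
have v0 s : 0 <= s < 1 -> 0 <= k ^+ 2 / ch (U s) ^+ 2 * U1 s.
  move=> s01; apply: mulr_ge0; last exact/ltW/U1_gt0.
  by rewrite divr_ge0// sqr_ge0.
have cQ s : 0 <= s < 1 -> {for s, continuous (fun s => Q (U s) ^+ 2 * U1 s)}.
  by move=> s01; exact: (continuous_compU1 s01 (is_derive_sqrR (dQ (U s)))).
have <- : (\int[mu]_(s in `[0%R, 1%R[) (k ^+ 2 / ch (U s) ^+ 2 * U1 s)%:E =
  (k ^+ 2 * (1 - sh (U 0) / ch (U 0)))%:E)%E.
  rewrite mulrBr; apply: (@FTC_right_open _
    (fun s => k ^+ 2 / ch (U s) ^+ 2 * U1 s)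
    (fun s => k ^+ 2 * (sh (U s) / ch (U s))) 0 1 (k ^+ 2 * 1)); first exact: ltr01.
  - exact: v0.
  - exact: cv.
  - move=> s s01; have := is_derive_compR (dU s01) (dtanh (U s)); exact.
  - apply: cvgM; first exact: cvg_cst.
    exact: (@cvg_comp _ _ _ U (fun u => sh u / ch u) _ _ _
      (escape_cvg dU U1_gt0 far) tanh_cvg).
apply: ge0_le_integral.
- exact: measurable_itv.
- move=> s; rewrite /= in_itv/= => s01.
  by rewrite lee_fin mulr_ge0 ?sqr_ge0// ltW// U1_gt0.
- apply/measurable_EFinP; apply: continuous_measurable.
    exact: measurable_itv.
  by move=> s; rewrite /= in_itv/=; exact: cQ.
- apply/measurable_EFinP; apply: continuous_measurable.
    exact: measurable_itv.
  by move=> s; rewrite /= in_itv/=; exact: cv.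
- move=> s; rewrite /= in_itv/= => s01; rewrite lee_fin ler_pM2r ?U1_gt0//.
  have w0 : 0 < ch (U s) ^+ 2 by rewrite exprn_gt0// ch_gt0.
  rewrite ler_pdivlMr//.
  have -> : Q (U s) ^+ 2 * ch (U s) ^+ 2 = k ^+ 2 * (ch (U s) ^+ 2 / D (U s)) ^+ 2.
    by rewrite /Q; field; exact: DN0.
  apply: ler_piMr; first exact: sqr_ge0.
  apply: exprn_ile1; first by rewrite divr_ge0// ltW.
  by rewrite ler_pdivrMr// mul1r lerDr sqr_ge0.
Qed.

Lemma inverted_catenoid_energy : arc_energy xc a d (Some x0) c.
Proof.
have mK : measurable (off_axis c `[0, 1[) by exact: measurable_off_axis_arc.
have K01 s : off_axis c `[0, 1[ s -> 0 <= s < 1.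
  by rewrite off_axis01 /= in_itv.
exists (4 * pi * (1 - T (U 0))), 0; split.
- rewrite (revol_willmoreE mK (h := fun s => J (U s) * U1 s)).
  + by rewrite off_axis01 integral_J -EFinM; congr EFin; field.
  + apply: continuous_measurable => // s /K01 s01.
    by have [b db] := dJ (U s); exact: continuous_compU1 db.
  + move=> s /K01 s01; split; last exact: curvatureE.
    by rewrite speedE// gt_eqF// mulr_gt0// U1_gt0.
- apply: (density_finite_area_arc dc (h := fun s => Q (U s) ^+ 2 * U1 s)
    (A := k ^+ 2 * (1 - sh (U 0) / ch (U 0)))).
  + apply: continuous_measurable => // s /K01 s01.
    exact: (continuous_compU1 s01 (is_derive_sqrR (dQ (U s)))).
  + by move=> s /K01 s01; rewrite areaE.
  + by rewrite off_axis01; exact: integral_area.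
- by rewrite start; ring.
Qed.

End InvertedCatenoid.
End CatenoidArcs.

(** * Dilated catenoids *)

(** As for the inverted catenoid, the sign sg lets the arc run towards u = +oo.
    The point m of the axis corresponds to the origin of the Euclidean plane, from
    which the density at infinity is measured. *)
Section DilatedCatenoid.
Context {R : realType}.
Local Notation mu := (@lebesgue_measure R).
Implicit Types s u : R.
Variables (r k sg : R).
Hypotheses (k0 : 0 < k) (sg1 : sg * sg = 1).
Let m := - (sg * r / k).
Let P u := r + sg * k * u.
Let Q u := k * ch u.
Let P1 u := sg * k.
Let Q1 u := k * sh u.
Let P2 u : R := 0.
Let Q2 u := k * ch u.

Let kN0 : k != 0. Proof. exact: lt0r_neq0. Qed.
Let chN0 u : ch u != 0. Proof. by rewrite gt_eqF// ch_gt0. Qed.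

Let dP u : is_derive u (1 : R) P (P1 u).
Proof.
have := is_derive_addR (is_derive_cstR r u)
  (is_derive_mulR (is_derive_cstR (sg * k) u) (is_derive_idR u)).
by move=> /is_derive_congr; apply; rewrite /P1; ring.
Qed.

Let dQ u : is_derive u (1 : R) Q (Q1 u).
Proof.
have := is_derive_mulR (is_derive_cstR k u) (is_derive_ch u).
by move=> /is_derive_congr; apply; rewrite mul0r add0r.
Qed.

Let dP1 u : is_derive u (1 : R) P1 (P2 u).
Proof. exact: is_derive_cstR. Qed.

Let dQ1 u : is_derive u (1 : R) Q1 (Q2 u).
Proof.
have := is_derive_mulR (is_derive_cstR k u) (is_derive_sh u).
by move=> /is_derive_congr; apply; rewrite mul0r add0r.
Qed.

Let Q0 u : 0 < Q u. Proof. by rewrite mulr_gt0// ch_gt0. Qed.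

Let PQ u : P1 u ^+ 2 + Q1 u ^+ 2 = Q u ^+ 2.
Proof.
transitivity (k ^+ 2 * (sg * sg + sh u ^+ 2)); first by rewrite /P1 /Q1; ring.
by rewrite sg1 -sqr_ch /Q; ring.
Qed.

Variables (c : R -> R * R) (U U1 : R -> R) (xc a d : R).
Hypothesis dc : twice_derivable c.
Hypothesis dU : forall s, 0 <= s < 1 -> is_derive s (1 : R) U (U1 s).
Hypothesis dU1 : forall s, 0 <= s < 1 -> derivable U1 s 1.
Hypothesis U1_gt0 : forall s, 0 <= s < 1 -> 0 < U1 s.
Hypothesis cE : forall s, 0 <= s < 1 -> c s = (r + sg * k * U s, k * ch (U s)).
Hypothesis far : forall A : R, exists2 s, 0 <= s < 1 &
  A < sqr_dist_catenary m (U s).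

Let cPQ s : 0 <= s < 1 -> c s = (P (U s), Q (U s)).
Proof. exact: cE. Qed.

Let K01 : off_axis c `[0, 1[ = `[0, 1[%classic.
Proof.
apply/seteqP; split=> s; first by case.
by rewrite /= in_itv/= => s01; split; rewrite /= ?in_itv//= cPQ//=.
Qed.

Let speedE s : 0 <= s < 1 -> speed c s = Q (U s) * U1 s.
Proof.
by move=> s01; rewrite (reparam_speed dP dQ Q0 PQ dc dU cPQ)// gtr0_norm// U1_gt0.
Qed.

Let areaE s : 0 <= s < 1 -> (c s).2 * speed c s = Q (U s) ^+ 2 * U1 s.
Proof. by move=> s01; rewrite speedE// cPQ//=; ring. Qed.

Let minimal s : 0 <= s < 1 -> mean_curvature c s = 0.
Proof.
move=> s01; rewrite (reparam_curvature dP dQ dP1 dQ1 Q0 PQ dc dU dU1 cPQ)// ?U1_gt0//.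
by rewrite /P1 /P2 /Q1 /Q2 /Q; field; rewrite kN0 chN0.
Qed.

Let N s := k ^+ 2 * sqr_dist_catenary m (U s).

Let normE s : 0 <= s < 1 -> (c s).1 ^+ 2 + (c s).2 ^+ 2 = N s.
Proof.
move=> s01; rewrite cPQ//= /N /sqr_dist_catenary /m.
transitivity ((k * U s) ^+ 2 + 2 * r * sg * k * U s + r ^+ 2 + Q (U s) ^+ 2).
  transitivity ((sg * sg) * (k * U s) ^+ 2 + 2 * r * sg * k * U s + r ^+ 2 +
    Q (U s) ^+ 2); last by rewrite sg1 mul1r.
  by rewrite /P; ring.
transitivity ((k * U s) ^+ 2 + 2 * r * sg * k * U s + (sg * sg) * r ^+ 2 +
  Q (U s) ^+ 2); first by rewrite sg1 mul1r.
by rewrite /Q opprK; field; exact: kN0.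
Qed.

(* 2 pi A is a primitive of the area density. *)
Let A u := k ^+ 2 / 2 * (u + sh u * ch u).

Let dA u : is_derive u (1 : R) A (Q u ^+ 2).
Proof.
have := is_derive_mulR (is_derive_cstR (k ^+ 2 / 2) u) (is_derive_addR
  (is_derive_idR u) (is_derive_mulR (is_derive_sh u) (is_derive_ch u))).
move=> /is_derive_congr; apply; rewrite mul0r add0r.
transitivity (k ^+ 2 / 2 * ((1 + sh u ^+ 2) + ch u ^+ 2)); first by ring.
by rewrite -sqr_ch /Q; field.
Qed.

Let cU s : 0 <= s < 1 -> {for s, continuous U}.
Proof. by move=> /dU; exact: is_derive_continuous. Qed.

Let cU1 s : 0 <= s < 1 -> {for s, continuous U1}.
Proof. by move=> /dU1 /derivable_is_derive; exact: is_derive_continuous. Qed.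

Let dAU s : 0 <= s < 1 ->
  is_derive s (1 : R) (fun s => A (U s)) (Q (U s) ^+ 2 * U1 s).
Proof. by move=> s01; exact: (is_derive_compR (dU s01) (dA (U s))). Qed.

Let area_ge0 s : 0 <= s < 1 -> 0 <= Q (U s) ^+ 2 * U1 s.
Proof. by move=> s01; rewrite mulr_ge0 ?sqr_ge0// ltW// U1_gt0. Qed.

Let carea s : 0 <= s < 1 -> {for s, continuous (fun s => Q (U s) ^+ 2 * U1 s)}.
Proof.
move=> s01; apply: cvgM; last exact: cU1.
apply: (@continuous_comp _ _ _ U (fun u => Q u ^+ 2)); first exact: cU.
exact: is_derive_continuous (is_derive_sqrR (dQ (U s))).
Qed.

Let cN s : 0 <= s < 1 -> {for s, continuous N}.
Proof.
move=> s01; apply: cvgM; first exact: cvg_cst.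
apply: (@continuous_comp _ _ _ U (sqr_dist_catenary m)); first exact: cU.
exact: is_derive_continuous (is_derive_sqr_dist m (U s)).
Qed.

(* The ratio of the area up to the parameter u to that of the disc whose radius
   is the distance of the point at u from the origin. *)
Let G u := 2 * (A u - A (U 0)) / (k ^+ 2 * sqr_dist_catenary m u).

Let G_cvg : G u @[u --> +oo] --> (1 : R).
Proof.
pose C := m - 2 * A (U 0) / k ^+ 2.
have -> : G = fun u => catenoid_primitive m u + C / sqr_dist_catenary m u.
  apply/funext => u; rewrite /G /catenoid_primitive /C {1}/A; field.
  by rewrite kN0 lt0r_neq0// sqr_dist_gt0.
rewrite -[X in _ --> X]addr0; apply: cvgD; first exact: catenoid_primitive_cvg.
apply: (@cvg_le_inv _ _ _ (48 * `|C|)) => u u1.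
have D0 := sqr_dist_gt0 m u; have v0 := ch_gt0 u; have v1 := ch_ge1 u.
have u4 := @ch_ge_pow4 R u ltac:(lra).
rewrite subr0 normrM normfV (gtr0_norm D0) ler_pdivrMr//.
rewrite (mulrAC _ u^-1) ler_pdivlMr; last by lra.
rewrite (mulrC 48) -!mulrA; apply: ler_wpM2l => //.
have h1 : u ^+ 1 <= u ^+ 4 by apply: ler_weXn2l.
have h2 : ch u <= ch u ^+ 2 by rewrite expr2; apply: ler_peMl => //; exact: ltW.
have h3 : ch u ^+ 2 <= sqr_dist_catenary m u by rewrite lerDr sqr_ge0.
rewrite expr1 in h1; lra.
Qed.

Let eventually_far (B : R) : exists2 s1, 0 <= s1 < 1 &
  forall s, s1 <= s < 1 -> B < N s.
Proof.
pose B' := Num.max 1 (48 * (B / k ^+ 2)).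
have [s1 s01 Us1] := escape_unbounded dU U1_gt0 far B'.
exists s1 => // s ss1.
have le1 : U s1 <= U s by apply: (escape_le dU U1_gt0); lra.
have [U1' UB] : 1 < U s /\ 48 * (B / k ^+ 2) < U s.
  by move: (lt_le_trans Us1 le1); rewrite gt_max => /andP[].
have u4 := @ch_ge_pow4 R (U s) ltac:(lra).
have h1 : U s ^+ 1 <= U s ^+ 4 by apply: ler_weXn2l => //; exact: ltW.
have v1 := ch_ge1 (U s).
have h2 : ch (U s) <= ch (U s) ^+ 2.
  by rewrite expr2; apply: ler_peMl => //; lra.
have h3 : ch (U s) ^+ 2 <= sqr_dist_catenary m (U s) by rewrite lerDr sqr_ge0.
have h4 : B / k ^+ 2 < sqr_dist_catenary m (U s) by rewrite expr1 in h1; lra.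
by move: h4; rewrite ltr_pdivrMr ?exprn_gt0// mulrC.
Qed.

Let initially_near t : 0 <= t < 1 ->
  exists B : R, forall s, 0 <= s <= t -> N s <= B.
Proof.
move=> t01; pose b := `|U 0| + `|U t|.
exists (k ^+ 2 * ((b + `|m|) ^+ 2 + expR b ^+ 2)) => s st.
apply: ler_wpM2l; first exact: sqr_ge0.
apply: sqr_dist_bound.
have h1 : U 0 <= U s by apply: (escape_le dU U1_gt0); lra.
have h2 : U s <= U t by apply: (escape_le dU U1_gt0); lra.
have := ler_norm (U t); have := ler_norm (- U 0); rewrite normrN.
have := normr_ge0 (U t); have := normr_ge0 (U 0).
by move=> *; rewrite ler_norml /b; lra.
Qed.

Let in_ballE rr s : 0 < rr -> 0 <= s < 1 -> in_ball c rr s <-> N s < rr ^+ 2.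
Proof.
move=> rr0 s01; rewrite /in_ball/= normE//.
have N0 : 0 <= N s.
  by rewrite mulr_ge0 ?sqr_ge0// ltW// sqr_dist_gt0.
rewrite -[X in _ < X ^+ 2](@ger0_norm _ rr) ?ltW//.
rewrite -{2}(sqr_sqrtr N0) real_normK ?num_real//.
by rewrite ltr_pXn2r// ?nnegrE ?sqrtr_ge0// ltW.
Qed.

(** For large radii the part of the curve in the ball lies between the part
    before the first and the part before the last exit from the ball. *)
Let area_growth (e : R) : 0 < e -> exists r0 : R, forall rr : R, r0 < rr ->
  (((1 - e) * (pi * rr ^+ 2))%:E <=
   area_in_ball (revol c) (revol_dom c `[0%R, 1%R[) rr <=
   ((1 + e) * (pi * rr ^+ 2))%:E)%E.
Proof.
move=> e0.
have [u0 [_ hu0]] : \forall u \near +oo, `|G u - 1| <= e.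
  have /cvgrPdist_le/(_ _ e0) := G_cvg.
  by apply: filterS => u; rewrite distrC.
have [s0 s01 Us0] := escape_unbounded dU U1_gt0 far u0.
have [B hB] := initially_near s01.
exists (Num.max 1 B) => rr; rewrite gt_max => /andP[rr1 rrB].
have rr0 : 0 < rr by lra.
have rr2 : rr <= rr ^+ 2 by rewrite expr2 ler_pMl//; exact: ltW.
have near s : 0 <= s <= s0 -> N s < rr ^+ 2.
  by move=> /hB; lra.
have [s1 s101 s1far] := eventually_far (rr ^+ 2).
have Ns1 : rr ^+ 2 < N s1 by apply: s1far; lra.
have s0s1 : s0 < s1.
  by rewrite ltNge; apply/negP => s1s0; have := near s1 ltac:(lra); lra.
have half s : s0 <= s < 1 -> N s = rr ^+ 2 ->
    (1 - e) * (rr ^+ 2 / 2) <= A (U s) - A (U 0) <= (1 + e) * (rr ^+ 2 / 2).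
  move=> ss0 Ns.
  have Us : u0 < U s.
    by apply: (lt_le_trans Us0); apply: (escape_le dU U1_gt0); lra.
  have := hu0 _ Us; rewrite /G -/(N s) Ns ler_norml => /andP[g1 g2].
  have -> : A (U s) - A (U 0) =
      2 * (A (U s) - A (U 0)) / rr ^+ 2 * (rr ^+ 2 / 2).
    by field; rewrite lt0r_neq0.
  by apply/andP; split; apply: ler_wpM2r; rewrite ?divr_ge0 ?sqr_ge0//; lra.
have mK : measurable (off_axis c `[0, 1[) by exact: measurable_off_axis_arc.
have mball : measurable (off_axis c `[0, 1[ `&` in_ball c rr).
  apply: measurable_in_ball; first exact: measurable_itv.
    by move=> s; rewrite /= in_itv/= => /dc[/is_derive_continuous].
  by move=> s; rewrite /= in_itv/= => /dc[_ /is_derive_continuous].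
have marea : measurable_fun (off_axis c `[0, 1[) (fun s => Q (U s) ^+ 2 * U1 s).
  apply: continuous_measurable => // s; rewrite K01 /= in_itv/=; exact: carea.
rewrite (area_in_ballE mK mball marea); last first.
  by move=> s; rewrite K01 /= in_itv/=; exact: areaE.
rewrite K01 in mK mball marea *.
apply/andP; split.
- have [||||t [ts Nt tN]] := @first_zero R (fun s => rr ^+ 2 - N s) s0 s1 => //.
  + move=> s ss; apply: cvgB; [exact: cvg_cst|apply: cN; lra].
  + by rewrite subr_gt0 near//; lra.
  + by rewrite subr_le0 ltW.
  have t1 : t < 1 by lra.
  have I : (\int[mu]_(s in `[0%R, t[) (Q (U s) ^+ 2 * U1 s)%:E =
     (A (U t) - A (U 0))%:E)%E.
    apply: (@FTC_right_open _ (fun s => Q (U s) ^+ 2 * U1 s)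
      (fun s => A (U s)) 0 t (A (U t))); first by lra.
    + by move=> s st; apply: area_ge0; lra.
    + by move=> s st; apply: carea; lra.
    + by move=> s st; apply: dAU; lra.
    + have t01 : 0 <= t < 1 by lra.
      exact: (cvg_at_left_filter (is_derive_continuous (dAU t01))).
  apply: (@le_trans _ _ ((2 * pi)%:E * (A (U t) - A (U 0))%:E)%E).
    have /andP[+ _] := half t ltac:(lra) ltac:(lra).
    rewrite -EFinM lee_fin => /(ler_wpM2l (pi_ge0 R)); lra.
  rewrite -I; apply: lee_pmul => //.
  + by rewrite lee_fin mulr_ge0// pi_ge0.
  + apply: integral_ge0 => s; rewrite /= in_itv/= => st.
    by rewrite lee_fin area_ge0//; lra.
  apply: ge0_subset_integral => //.
  + apply/measurable_EFinP; apply: measurable_funS marea => //.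
  + by move=> s [+ _]; rewrite /= in_itv/= => s01'; rewrite lee_fin area_ge0.
  + move=> s; rewrite /= in_itv/= => st; split; first by rewrite /= in_itv/=; lra.
    apply/in_ballE => //; first lra.
    have [ss0|ss0] := leP s s0; first by apply: near; lra.
    by have := tN s ltac:(lra); lra.
- have [||||t [ts Nt tN]] := @last_zero R (fun s => N s - rr ^+ 2) s0 s1 => //.
  + move=> s ss; apply: cvgB; [apply: cN; lra|exact: cvg_cst].
  + by rewrite subr_le0 ltW// near//; lra.
  + by rewrite subr_gt0.
  have t1 : t < 1 by lra.
  have s0t : s0 < t.
    rewrite lt_neqAle (andP ts).1 andbT; apply/eqP => s0t.
    by have := near s0 ltac:(lra); rewrite s0t; lra.
  apply: (@le_trans _ _ ((2 * pi)%:E * (A (U t) - A (U 0))%:E)%E); last first.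
    have /andP[_ +] := half t ltac:(lra) ltac:(lra).
    rewrite -EFinM lee_fin => /(ler_wpM2l (pi_ge0 R)); lra.
  apply: lee_pmul => //.
  + by rewrite lee_fin mulr_ge0// pi_ge0.
  + apply: integral_ge0 => s [+ _].
    by rewrite /= in_itv/= => s01'; rewrite lee_fin area_ge0.
  have <- : (\int[mu]_(s in `[0%R, t]) (Q (U s) ^+ 2 * U1 s)%:E =
     (A (U t) - A (U 0))%:E)%E.
    apply: (@FTC_closed _ (fun s => Q (U s) ^+ 2 * U1 s)
      (fun s => A (U s)) 0 t); first by lra.
    + by move=> s st; apply: carea; lra.
    + by move=> s st; apply: dAU; lra.
  apply: ge0_subset_integral => //.
  + apply/measurable_EFinP; apply: measurable_funS marea => //.
    by move=> s; rewrite /= !in_itv/=; lra.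
  + by move=> s; rewrite /= in_itv/= => st; rewrite lee_fin area_ge0//; lra.
  + move=> s [+ /in_ballE]; rewrite /= !in_itv/= => s01' /(_ rr0 s01') Ns.
    rewrite (andP s01').1 /= leNgt; apply/negP => ts'.
    have [ss1|ss1] := leP s s1; first by have := tN s ltac:(lra); lra.
    by have := s1far s ltac:(lra); lra.
Qed.

Lemma dilated_catenoid_energy : arc_energy xc a d None c.
Proof.
have mK : measurable (off_axis c `[0, 1[) by exact: measurable_off_axis_arc.
have K s : off_axis c `[0, 1[ s -> 0 <= s < 1 by rewrite K01 /= in_itv.
exists 0, 1; split; last by rewrite mulr0; ring.
- rewrite (revol_willmoreE mK (h := fun=> 0)).
  + by rewrite integral0 mule0.
  + exact: measurable_cst.
  + move=> s /K s01; rewrite minimal// expr0n mul0r; split=> //.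
    by rewrite speedE// gt_eqF// mulr_gt0// U1_gt0.
- apply: density_limit; exact: area_growth.
Qed.

End DilatedCatenoid.

(** * Energy of a comparison arc *)

Section ComparisonArcs.
Context {R : realType}.
Implicit Types s t u : R.

Lemma near_left_exists (p : R -> Prop) : (\forall s \near (1 : R)^'-, p s) ->
  exists2 s, 0 <= s < 1 & p s.
Proof.
move=> pn; have [s [ps s0 s1]] : exists s, [/\ p s, 0 < s & s < 1].
  apply: (@filter_ex _ (1 : R)^'-); near=> s; split.
  - by near: s.
  - by near: s; apply: nbhs_left_gt.
  - by near: s; apply: nbhs_left_lt.
by exists s => //; rewrite s1 ltW.
Unshelve. all: end_near. Qed.

Lemma reparam_immersed (P Q tau tau1 : R -> R) (c : R -> R * R) s :
  (forall u, exists b, is_derive u (1 : R) P b) ->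
  (forall u, exists b, is_derive u (1 : R) Q b) ->
  twice_derivable c ->
  (forall s, 0 <= s < 1 -> is_derive s (1 : R) tau (tau1 s)) ->
  (forall s, 0 <= s < 1 -> c s = (P (tau s), Q (tau s))) ->
  0 <= s < 1 -> speed c s != 0 -> tau1 s != 0.
Proof.
move=> dP dQ dc dt cE s01; apply: contra => /eqP t0.
have [dX dY _ _] := dc s s01.
have [b db] := dP (tau s); have [b' db'] := dQ (tau s).
have x1 := is_derive_arc_unique s01 (f := fst \o c) (g := fun s => P (tau s))
  (fun u u01 => congr1 fst (cE u u01)) dX (is_derive_compR (dt s s01) db).
have y1 := is_derive_arc_unique s01 (f := snd \o c) (g := fun s => Q (tau s))
  (fun u u01 => congr1 snd (cE u u01)) dY (is_derive_compR (dt s s01) db').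
by rewrite /speed x1 y1 t0 !mulr0 expr0n addr0 sqrtr0.
Qed.

Lemma orient (tau tau1 : R -> R) :
  (forall s, 0 <= s < 1 -> is_derive s (1 : R) tau (tau1 s)) ->
  (forall s, 0 <= s < 1 -> derivable tau1 s 1) ->
  (forall s, 0 <= s < 1 -> tau1 s != 0) ->
  exists sg : R, [/\ sg = 1 \/ sg = -1,
    forall s, 0 <= s < 1 -> is_derive s (1 : R) (fun s => sg * tau s) (sg * tau1 s),
    forall s, 0 <= s < 1 -> derivable (fun s => sg * tau1 s) s 1 &
    forall s, 0 <= s < 1 -> 0 < sg * tau1 s].
Proof.
move=> dt dt1 t0.
have [s s01|sg [sg1 pos]] := constant_sign _ t0.
  exact: is_derive_continuous (derivable_is_derive (dt1 s s01)).
exists sg; split; [exact: sg1|move=> s s01|move=> s s01|exact: pos].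
  have := is_derive_mulR (is_derive_cstR sg s) (dt s s01).
  by move=> /is_derive_congr; apply; rewrite mul0r add0r.
by have [] := is_derive_mulR (is_derive_cstR sg s) (derivable_is_derive (dt1 s s01)).
Qed.

Lemma ch_sign (sg u : R) : sg = 1 \/ sg = -1 -> ch (sg * u) = ch u.
Proof. by case=> ->; rewrite ?mulN1r ?chN ?mul1r. Qed.

Lemma sign_sqr (sg : R) : sg = 1 \/ sg = -1 -> sg * sg = 1.
Proof. by case=> ->; rewrite ?mulrNN mulr1. Qed.

Section Arc.
Variables (xc a b d : R) (x : @axis_point R) (c : R -> R * R).
Hypotheses (a0 : 0 < a) (cb : cos b = d) (sb : sin b = 0).
Hypothesis d1 : d = 1 \/ d = -1.
Hypothesis arc : comparison_arc xc a b x c.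

Let dc : twice_derivable c.
Proof.
have [dn _ _ _ _] := arc; move=> s s01.
have [h1 h2] : derivable (fst \o c) s 1 /\ derivable (snd \o c) s 1 :=
  dn 0%N s s01.
have [h3 h4] : derivable (derive1 (fst \o c)) s 1 /\
  derivable (derive1 (snd \o c)) s 1 := dn 1%N s s01.
split; [exact: (derivable_is_derive h1)|exact: (derivable_is_derive h2)
  |exact: (derivable_is_derive h3)|exact: (derivable_is_derive h4)].
Qed.

Let Y0 s : 0 <= s < 1 -> 0 <= (c s).2.
Proof. by have [_ [Y _] _ _ _] := arc; exact: Y. Qed.

Let imm s : 0 <= s < 1 -> 0 < (c s).2 -> speed c s != 0.
Proof. by have [_ [_ sp] _ _ _] := arc; exact: sp. Qed.

Let c0 : c 0 = (xc, a).
Proof. by have [_ _ [? _] _ _] := arc. Qed.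

Let z01 : 0 <= (0 : R) < 1. Proof. by rewrite lexx ltr01. Qed.

Let speed0 : speed c 0 != 0.
Proof. by apply: imm; rewrite ?c0. Qed.

Let x10 : derive1 (fst \o c) 0 = d * speed c 0.
Proof.
have [_ _ [_ [e _]] _ _] := arc.
by rewrite -cb -e -/(speed c 0) divfK.
Qed.

Let y10 : derive1 (snd \o c) 0 = 0.
Proof.
have [_ _ [_ [_ +]] _ _] := arc; rewrite sb -/(speed c 0) => /eqP.
by rewrite mulf_eq0 invr_eq0 (negbTE speed0) orbF => /eqP.
Qed.

Let end_cvg xe : x = Some xe -> c s @[s --> 1^'-] --> (xe, 0 : R).
Proof. by move=> xE; have [_ _ _ + _] := arc; rewrite xE => -[<-]. Qed.

Let end_new xe : x = Some xe -> forall s, 0 <= s < 1 -> c s <> (xe, 0).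
Proof. by move=> xE; have [_ _ _ + _] := arc; rewrite xE => -[]. Qed.

Let fst_cvg xe : x = Some xe -> (c s).1 @[s --> 1^'-] --> xe.
Proof.
by move=> /end_cvg cxe; apply: (cvg_comp _ _ cxe); exact: cvg_fst.
Qed.

Let snd_cvg xe : x = Some xe -> (c s).2 @[s --> 1^'-] --> 0.
Proof.
by move=> /end_cvg cxe; apply: (cvg_comp _ _ cxe); exact: cvg_snd.
Qed.

Let far_infty (B : R) : x = None -> exists2 s, 0 <= s < 1 &
  B < (c s).1 ^+ 2 + (c s).2 ^+ 2.
Proof.
move=> xN; have [_ _ _ + _] := arc; rewrite xN => /cvgryPgt/(_ (1 + `|B|)).
move=> /near_left_exists[s s01 Bs]; exists s => //.
rewrite -[ltRHS]sqr_sqrtr; last by rewrite addr_ge0// sqr_ge0.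
have := ler_norm B; have := normr_ge0 B; move=> h1 h2.
have h3 : 0 <= `|B| ^+ 2 by rewrite sqr_ge0.
apply: (@lt_le_trans _ _ ((1 + `|B|) ^+ 2)); first by lra.
by apply: lerXn2r; rewrite ?nnegrE ?sqrtr_ge0 ?ltW// ltr_wpDl.
Qed.

(** The horizontal start forces the center to lie below the starting point. *)
Lemma half_circle_arc (a' r' : R) :
  (forall s, 0 <= s < 1 -> half_circle a' r' (c s)) -> arc_energy xc a d x c.
Proof.
move=> hc.
have circ' s : 0 <= s < 1 -> ((c s).1 + - a') ^+ 2 + (c s).2 ^+ 2 = r' ^+ 2.
  by move=> /hc[].
have [dX dY _ _] := dc z01.
have a'E : a' = xc.
  have := is_derive_arc_unique z01 circ' (is_derive_addR
    (is_derive_sqrR (is_derive_addR dX (is_derive_cstR (- a') 0)))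
    (is_derive_sqrR dY)) (is_derive_cstR (r' ^+ 2) 0).
  rewrite x10 y10 /= c0/= mulr0 !addr0 => /eqP.
  have dN0 : d != 0 by case: d1 => ->; rewrite ?oppr_eq0 oner_eq0.
  rewrite !mulf_eq0 (negbTE speed0) (negbTE dN0) !orbF pnatr_eq0/= subr_eq0.
  by move=> /eqP.
have circ s : 0 <= s < 1 -> ((c s).1 - xc) ^+ 2 + (c s).2 ^+ 2 = a ^+ 2.
  have := circ' 0 z01; rewrite c0/= a'E subrr expr0n add0r => ->.
  by move=> /circ'; rewrite a'E.
case xE : x => [xe|].
  apply: half_circle_energy => //.
  - exact: end_cvg.
  - exact: end_new.
have [s s01] := far_infty (2 * a ^+ 2 + 2 * xc ^+ 2) xE.
have := circ s s01; have := sqr_ge0 ((c s).1 - 2 * xc).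
by move=> h1 h2 h3; exfalso; nra.
Qed.

(** The height is bounded below, which excludes an end on the axis. *)
Lemma dilated_catenoid_arc (k r : R) : 0 < k ->
  (forall s, 0 <= s < 1 -> exists t, c s = (r + k * t, k * ch t)) ->
  arc_energy xc a d x c.
Proof.
move=> k0 cC; have kN0 := lt0r_neq0 k0.
pose tau s := ((c s).1 - r) / k.
have cE s : 0 <= s < 1 -> c s = (r + k * tau s, k * ch (tau s)).
  move=> /cC[t cs]; rewrite /tau cs/=.
  have -> : (r + k * t - r) / k = t by field.
  by [].
have Ypos s : 0 <= s < 1 -> 0 < (c s).2.
  by move=> s01; rewrite cE//= mulr_gt0// ch_gt0.
case xE : x => [xe|].
  have [s s01] : exists2 s, 0 <= s < 1 & (c s).2 < k.
    by apply: near_left_exists; apply: (cvgr_lt _ (snd_cvg xE)).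
  rewrite cE//= => Yk; exfalso; have v1 := ch_ge1 (tau s).
  by have := ler_wpM2l (ltW k0) v1; rewrite mulr1; lra.
pose tau1 s := derive1 (fst \o c) s / k.
have dt s : 0 <= s < 1 -> is_derive s (1 : R) tau (tau1 s).
  move=> /dc[dX _ _ _]; have := is_derive_mulR
    (is_derive_addR dX (is_derive_cstR (- r) s)) (is_derive_cstR k^-1 s).
  by move=> /is_derive_congr; apply; rewrite mulr0 !addr0.
have dt1 s : 0 <= s < 1 -> derivable tau1 s 1.
  by move=> /dc[_ _ dX _]; have [] := is_derive_mulR dX (is_derive_cstR k^-1 s).
have t0 s : 0 <= s < 1 -> tau1 s != 0.
  move=> s01; apply: (reparam_immersed (P := fun u => r + k * u)
    (Q := fun u => k * ch u) _ _ dc dt cE s01).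
  - move=> u; eexists; exact: (is_derive_addR (is_derive_cstR r u)
      (is_derive_mulR (is_derive_cstR k u) (is_derive_idR u))).
  - move=> u; eexists.
    exact: (is_derive_mulR (is_derive_cstR k u) (is_derive_ch u)).
  - by apply: imm => //; exact: Ypos.
have [sg [sg1 dU dU1 U1_gt0]] := orient dt dt1 t0; have sg2 := sign_sqr sg1.
apply: (@dilated_catenoid_energy _ r k sg k0 sg2 c _ _ xc a d dc dU dU1 U1_gt0).
  move=> s s01; rewrite ch_sign// [LHS]cE//; congr (_, _).
  by transitivity (r + (sg * sg) * k * tau s); [rewrite sg2 mul1r|ring].
move=> A; have [s s01 As] := far_infty (k ^+ 2 * A) xE; exists s => //.
rewrite -(ltr_pM2l (exprn_gt0 2 k0)); apply: (lt_le_trans As).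
rewrite cE//= /sqr_dist_catenary ch_sign//.
rewrite le_eqVlt; apply/orP; left; apply/eqP.
transitivity ((sg * sg) * (r + k * tau s) ^+ 2 + (k * ch (tau s)) ^+ 2).
  by rewrite sg2 mul1r.
by field.
Qed.

(** The parameter of the catenary is a rational function of the point of the arc,
    since inversion is an involution; hence it inherits the regularity of c. *)
Lemma inverted_catenoid_arc (k x0 q : R) : 0 < k ->
  (forall s, 0 <= s < 1 -> exists t, c s =
     (x0 - k * (t - q) / sqr_dist_catenary q t,
      k * ch t / sqr_dist_catenary q t)) ->
  arc_energy xc a d x c.
Proof.
move=> k0 cC; have kN0 := lt0r_neq0 k0.
pose rho s := ((c s).1 + - x0) ^+ 2 + (c s).2 ^+ 2.
pose tau s := q + - (k * (((c s).1 + - x0) * (rho s)^-1)).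
have cE' s : 0 <= s < 1 -> [/\ c s =
     (x0 - k * (tau s - q) / sqr_dist_catenary q (tau s),
      k * ch (tau s) / sqr_dist_catenary q (tau s)) &
     rho s = k ^+ 2 / sqr_dist_catenary q (tau s)].
  move=> /cC[t cs]; have DN0 := lt0r_neq0 (sqr_dist_gt0 q t).
  have rE : rho s = k ^+ 2 / sqr_dist_catenary q t.
    rewrite /rho cs/=.
    transitivity (k ^+ 2 * sqr_dist_catenary q t / sqr_dist_catenary q t ^+ 2).
      by rewrite {3}/sqr_dist_catenary; field.
    by field.
  have tE : tau s = t by rewrite /tau rE cs/=; field; rewrite kN0 DN0.
  by rewrite tE.
have cE s : 0 <= s < 1 -> c s =
     (x0 - k * (tau s - q) / sqr_dist_catenary q (tau s),
      k * ch (tau s) / sqr_dist_catenary q (tau s)) by move=> /cE'[].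
have rE s : 0 <= s < 1 -> rho s = k ^+ 2 / sqr_dist_catenary q (tau s).
  by move=> /cE'[].
have D0 s := sqr_dist_gt0 q (tau s); have DN0 s := lt0r_neq0 (D0 s).
have rN0 s : 0 <= s < 1 -> rho s != 0.
  by move=> s01; rewrite rE// mulf_neq0 ?invr_eq0// expf_neq0.
have Ypos s : 0 <= s < 1 -> 0 < (c s).2.
  by move=> s01; rewrite cE//= divr_gt0// mulr_gt0// ch_gt0.
(* The curve lies in a horoball at x0, as the catenary lies above height 1. *)
have horo s : 0 <= s < 1 -> rho s <= k * (c s).2.
  move=> s01; rewrite rE// cE//= mulrA ler_pM2r ?invr_gt0// mulrA -expr2.
  by apply: ler_peMr; [exact: sqr_ge0|exact: ch_ge1].
have xE : x = Some x0.
  case xE : x => [xe|]; last first.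
    have [s s01] := far_infty (2 * k ^+ 2 + 2 * x0 ^+ 2) xE.
    have := horo s s01; have := Ypos s s01; rewrite /rho.
    have h1 := sqr_ge0 ((c s).1 - 2 * x0); have h2 := sqr_ge0 ((c s).2 - k).
    have h3 := sqr_ge0 ((c s).1 + - x0).
    by move=> h4 h5 h6; exfalso; nra.
  have lim1 : ((c s).1 + - x0) ^+ 2 @[s --> 1^'-] --> (xe + - x0) ^+ 2.
    by rewrite expr2; under eq_fun do rewrite expr2; apply: cvgM;
      apply: cvgD; (try exact: cvg_cst); exact: fst_cvg.
  have lim2 : k * (c s).2 @[s --> 1^'-] --> k * 0.
    by apply: cvgM; [exact: cvg_cst|exact: (snd_cvg xE)].
  have le0 : (xe + - x0) ^+ 2 <= k * 0.
    apply: ler_cvg_to lim1 lim2 _; near=> s.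
    have s0 : 0 < s by near: s; apply: nbhs_left_gt.
    have s1 : s < 1 by near: s; apply: nbhs_left_lt.
    have s01 : 0 <= s < 1 by rewrite s1 ltW.
    by apply: le_trans (horo s s01); rewrite lerDl sqr_ge0.
  congr Some; apply/eqP; rewrite -subr_eq0 -sqrf_eq0 eq_le sqr_ge0 andbT.
  by move: le0; rewrite mulr0.
have far (A : R) : exists2 s, 0 <= s < 1 & A < sqr_dist_catenary q (tau s).
  have B0 : 0 < k / (1 + `|A|) by rewrite divr_gt0// ltr_pwDl.
  have [s s01] : exists2 s, 0 <= s < 1 & (c s).2 < k / (1 + `|A|).
    by apply: near_left_exists; apply: (cvgr_lt _ (snd_cvg xE)).
  move=> Ys; exists s => //.
  have : k / sqr_dist_catenary q (tau s) < k / (1 + `|A|).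
    apply: le_lt_trans Ys; rewrite cE//= ler_pM2r ?invr_gt0//.
    by apply: ler_peMr; [exact: ltW|exact: ch_ge1].
  have A1 : 0 < 1 + `|A| by rewrite ltr_pwDl.
  rewrite ltr_pM2l// ltf_pV2 ?posrE// => AD.
  by have h := ler_norm A; lra.
pose rho1 s := 2 * ((c s).1 + - x0) * derive1 (fst \o c) s +
  2 * (c s).2 * derive1 (snd \o c) s.
have drho s : 0 <= s < 1 -> is_derive s (1 : R) rho (rho1 s).
  move=> /dc[dX dY _ _]; have := is_derive_addR
    (is_derive_sqrR (is_derive_addR dX (is_derive_cstR (- x0) s)))
    (is_derive_sqrR dY).
  by move=> /is_derive_congr; apply; rewrite addr0.
pose tau1 s := - (k * (derive1 (fst \o c) s * (rho s)^-1 +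
  ((c s).1 + - x0) * (- rho1 s * (rho s ^+ 2)^-1))).
have dt s : 0 <= s < 1 -> is_derive s (1 : R) tau (tau1 s).
  move=> s01; have [dX dY _ _] := dc s01.
  have := is_derive_addR (is_derive_cstR q s) (is_derive_oppR
    (is_derive_mulR (is_derive_cstR k s) (is_derive_mulR
      (is_derive_addR dX (is_derive_cstR (- x0) s))
      (is_derive_invR (drho s s01) (rN0 s s01))))).
  by move=> /is_derive_congr; apply; rewrite addr0 add0r mul0r add0r.
have dt1 s : 0 <= s < 1 -> derivable tau1 s 1.
  move=> s01; have [dX dY dX1 dY1] := dc s01.
  have dXx := is_derive_addR dX (is_derive_cstR (- x0) s).
  have drho1 := is_derive_addR
    (is_derive_mulR (is_derive_mulR (is_derive_cstR 2 s) dXx) dX1)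
    (is_derive_mulR (is_derive_mulR (is_derive_cstR 2 s) dY) dY1).
  have r2 : rho s ^+ 2 != 0 by rewrite expf_neq0// rN0.
  have dr2 := is_derive_invR (is_derive_sqrR (drho s s01)) r2.
  have [] := is_derive_oppR (is_derive_mulR (is_derive_cstR k s)
    (is_derive_addR (is_derive_mulR dX1 (is_derive_invR (drho s s01) (rN0 s s01)))
      (is_derive_mulR dXx (is_derive_mulR (is_derive_oppR drho1) dr2)))).
  by [].
have t0 s : 0 <= s < 1 -> tau1 s != 0.
  move=> s01; apply: (reparam_immersed
    (P := fun u => x0 + - (k * (u + - q) * (sqr_dist_catenary q u)^-1))
    (Q := fun u => k * ch u * (sqr_dist_catenary q u)^-1) _ _ dc dt cE s01).
  - move=> u; eexists; exact: (is_derive_addR (is_derive_cstR x0 u)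
      (is_derive_oppR (is_derive_mulR (is_derive_mulR (is_derive_cstR k u)
        (is_derive_addR (is_derive_idR u) (is_derive_cstR (- q) u)))
        (is_derive_invR (is_derive_sqr_dist q u)
          (lt0r_neq0 (sqr_dist_gt0 q u)))))).
  - move=> u; eexists; exact: (is_derive_mulR (is_derive_mulR
      (is_derive_cstR k u) (is_derive_ch u)) (is_derive_invR
      (is_derive_sqr_dist q u) (lt0r_neq0 (sqr_dist_gt0 q u)))).
  - by apply: imm => //; exact: Ypos.
have [sg [sg1 dU dU1 U1_gt0]] := orient dt dt1 t0; have sg2 := sign_sqr sg1.
have DE s : sqr_dist_catenary (sg * q) (sg * tau s) = sqr_dist_catenary q (tau s).
  rewrite /sqr_dist_catenary ch_sign//; congr (_ + _).
  by transitivity ((sg * sg) * (tau s - q) ^+ 2); [ring|rewrite sg2 mul1r].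
rewrite xE; apply: (@inverted_catenoid_energy _ x0 k (sg * q) sg k0 sg2 c _ _
  xc a d dc dU dU1 U1_gt0) => //.
- move=> s s01; rewrite DE ch_sign// [LHS]cE//; congr (_, _); last by rewrite mulrA.
  transitivity (x0 - (sg * sg) * k * (tau s - q) / sqr_dist_catenary q (tau s)).
    by rewrite sg2 mul1r.
  by ring.
- by move=> A; have [s s01 As] := far A; exists s; rewrite ?DE.
- exact: sign_sqr.
Unshelve. all: end_near. Qed.

Lemma comparison_arc_energy : arc_energy xc a d x c.
Proof.
have [_ _ _ _ [[C /moebius_catenoid_normal_form mC cC]|[a' [r' [_ hc]]]]] := arc.
  case: mC => [[k [r [k0 CE]]]|[k [x0 [q [k0 CE]]]]].
    apply: (dilated_catenoid_arc (r := r) k0) => s s01.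
    have [t] := CE _ (cC s s01).
    rewrite /to_complex => -[e1 e2].
    by exists t; rewrite [c s]surjective_pairing e1 e2.
  apply: (inverted_catenoid_arc (x0 := x0) (q := q) k0) => s s01.
  have [t] := CE _ (cC s s01).
  rewrite /to_complex => -[e1 e2].
  by exists t; rewrite [c s]surjective_pairing e1 e2.
exact: half_circle_arc hc.
Qed.

End Arc.
End ComparisonArcs.

(** * Comparison energy and its lower limit *)

Section Energies.
Context {R : realType}.
Implicit Types (am ap e : R) (x : @axis_point R).

Lemma comparison_energyE am ap x (cm cp : R -> R * R) : 0 < am -> 0 < ap ->
  comparison_pair (- 1) am 0 1 ap pi x cm cp ->
  comparison_energy (- 1) am 0 1 ap pi cm cp =
  (12 * pi + 4 * pi * (axis_fraction ap 1 x - axis_fraction am (- 1) x))%:E.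
Proof.
move=> am0 ap0 [arcm arcp].
have [Wm [Dm [Wm_eq Dm_eq Em]]] : arc_energy (-1) am 1 x cm.
  by apply: comparison_arc_energy arcm; rewrite ?cos0 ?sin0//; left.
have [Wp [Dp [Wp_eq Dp_eq Ep]]] : arc_energy 1 ap (-1) x cp.
  by apply: comparison_arc_energy arcp; rewrite ?cospi ?sinpi//; right.
have [capm dm] : cap_willmore (-1) am 0 = (2 * pi)%:E /\
    cap_density (-1) am 0 = 0%:E.
  by apply: cap_energy; rewrite ?sin0 ?cos0//; left.
have [capp dp] : cap_willmore 1 ap pi = (2 * pi)%:E /\
    cap_density 1 ap pi = 0%:E.
  by apply: cap_energy; rewrite ?sinpi ?cospi//; right.
rewrite /comparison_energy /willmore_closed !big_cons !big_nil /=.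
rewrite capm capp dm dp Wm_eq Wp_eq Dm_eq Dp_eq !mule0 !adde0.
rewrite -(EFinD Dm) -EFinM -!EFinD.
by congr EFin; lra.
Qed.

Lemma fraction_le_half (a t : R) : 0 < a -> `|a * t / (a ^+ 2 + t ^+ 2)| <= 2^-1.
Proof.
move=> a0; have p : 0 < a ^+ 2 + t ^+ 2 by rewrite ltr_pwDl ?sqr_ge0// exprn_gt0.
rewrite ler_norml ler_pdivlMr// ler_pdivrMr//.
have h1 := sqr_ge0 (a + t); have h2 := sqr_ge0 (a - t).
by apply/andP; split; nra.
Qed.

Lemma fraction_le_near (a t : R) : 0 < a ->
  `|a * t / (a ^+ 2 + t ^+ 2)| <= `|t| / a.
Proof.
move=> a0; have p : 0 < a ^+ 2 + t ^+ 2 by rewrite ltr_pwDl ?sqr_ge0// exprn_gt0.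
rewrite normrM normfV (gtr0_norm p) normrM (gtr0_norm a0) ler_pdivrMr//.
rewrite mulrAC ler_pdivlMr// (mulrC a) -mulrA -expr2.
by apply: ler_wpM2l => //; rewrite lerDl sqr_ge0.
Qed.

Lemma fraction_le_far (a t : R) : 0 < a -> t != 0 ->
  `|a * t / (a ^+ 2 + t ^+ 2)| <= a / `|t|.
Proof.
move=> a0 t0; have p : 0 < a ^+ 2 + t ^+ 2 by rewrite ltr_pwDl ?sqr_ge0// exprn_gt0.
rewrite normrM normfV (gtr0_norm p) normrM (gtr0_norm a0) ler_pdivrMr//.
rewrite mulrAC ler_pdivlMr ?normr_gt0// -mulrA -expr2 real_normK ?num_real//.
by apply: ler_wpM2l; [exact: ltW|rewrite lerDr sqr_ge0].
Qed.

(** Each fraction is extremal, of absolute value 1/2, where the distance from x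
    to the center equals the radius, and it is small far inside and far outside
    of this distance.  When the radii are very different, one of the two
    fractions is therefore small. *)
Lemma fraction_difference am e : 0 < am -> 0 < e -> exists M : R, 0 < M /\
  forall ap x, M < ap ->
    - 2^-1 - e <= axis_fraction ap 1 x - axis_fraction am (- 1) x.
Proof.
move=> am0 e0; have ae0 : 0 < am / e by rewrite divr_gt0.
exists ((am / e + 2) / e); split; first by rewrite divr_gt0// addr_gt0.
move=> ap [x|] apM; last by rewrite /= subrr; lra.
have ap0 : 0 < ap by apply: lt_trans apM; rewrite divr_gt0// addr_gt0.
rewrite /axis_fraction; set F := _ / _; set G := _ / _.
have /[!ler_norml] hF := fraction_le_half (x - 1) ap0.
have /[!ler_norml] hG := fraction_le_half (x - - 1) am0.
rewrite -/F in hF; rewrite -/G in hG.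
have [xn|xf] := leP `|x - - 1| (am / e).
  have : `|F| <= e.
    apply: le_trans (fraction_le_near _ ap0) _.
    rewrite ler_pdivrMr//; apply: (@le_trans _ _ (am / e + 2)); last first.
      by rewrite -ler_pdivrMl// mulrC ltW.
    rewrite (_ : x - 1 = (x - - 1) - 2); last by lra.
    by rewrite (le_trans (ler_normB _ _))// (ger0_norm (_ : 0 <= 2))// lerD2r.
  rewrite ler_norml => h; lra.
have t0 : x - - 1 != 0.
  by rewrite -normr_gt0 (lt_trans ae0).
have : `|G| <= e.
  apply: le_trans (fraction_le_far am0 t0) _.
  by rewrite ler_pdivrMr ?normr_gt0// -ler_pdivrMl// mulrC ltW.
by rewrite ler_norml => h; lra.
Qed.

Lemma liminf_comparison_energy am : 0 < am ->
  ((10 * pi : R)%:E <=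
   limf_einf (fun ap => inf_comparison_energy (- 1) am 0 1 ap pi) +oo%R)%E.
Proof.
move=> am0; rewrite limf_einfE; have p0 := pi_gt0 R.
apply/lee_subgt0Pr => e e0.
have [|M [M0 hM]] := @fraction_difference am (e / (4 * pi)) am0.
  by rewrite divr_gt0// mulr_gt0.
pose f ap := inf_comparison_energy (- 1) am 0 1 ap pi.
apply: (@le_trans _ _ (ereal_inf (f @` [set ap | M < ap]))).
  apply: le_ereal_inf_tmp => _ [ap Map <-]; apply: le_ereal_inf_tmp => w.
  move=> [x [cm [cp [pair ->]]]].
  rewrite (comparison_energyE am0 _ pair); last exact: lt_trans Map.
  rewrite -EFinB lee_fin.
  have h := hM ap x Map.
  have p4 : 0 < 4 * pi :> R by rewrite mulr_gt0.
  have := ler_wpM2l (ltW p4) h.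
  have -> : 4 * pi * (- 2^-1 - e / (4 * pi)) = - (2 * pi) - e :> R.
    rewrite mulrBr (mulrC _ (e / _)) divfK; last exact: lt0r_neq0.
    by lra.
  by move=> h'; lra.
apply: ereal_sup_ubound; exists [set ap | M < ap] => //.
by apply: nbhs_pinfty_gt; exact: num_real.
Qed.

End Energies.

Theorem theorem1p2 (R : realType) :
  (forall (am ap : R) (x : @axis_point R) (cm cp : R -> R * R),
     0 < am -> 0 < ap ->
     comparison_pair (- 1) am 0 1 ap pi x cm cp ->
     comparison_energy (- 1) am 0 1 ap pi cm cp =
       (12 * pi + 4 * pi * (axis_fraction ap 1 x - axis_fraction am (- 1) x))%:E)
  /\
  (forall am : R, 0 < am ->
     ((10 * pi : R)%:E <=
        limf_einf (fun ap : R => inf_comparison_energy (- 1) am 0 1 ap pi) +oo%R)%E).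
Proof.
split=> [am ap x cm cp|am].
  exact: comparison_energyE.
exact: liminf_comparison_energy.
Qed.
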